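(* Let $\beta>1$ and let $\psi_2:\mathbb{N}\to\mathbb{R}^+$ be a positive function with $\underline{v}_2\ge 0$. (a) If $\underline{v}_2>1$, then $\mathcal{U}(\psi_2)$ is countable. (b) If $\underline{v}_2\le 1<\overline{v}_2$, then $$0\le\dim_H\left(\mathcal{U}(\psi_2)\right)\le\min\left\{\frac{1}{1+\overline{v}_2},\ \left(\frac{1-\underline{v}_2}{1+\underline{v}_2}\right)^2\right\}.$$ (c) If $\overline{v}_2\le 1$, then $$\left(\frac{1-\overline{v}_2}{1+\overline{v}_2}\right)^2\le\dim_H\left(\mathcal{U}(\psi_2)\right)\le\min\left\{\frac{1}{1+\overline{v}_2},\ \left(\frac{1-\underline{v}_2}{1+\underline{v}_2}\right)^2\right\}.$$
   Context: For $\beta>1$, the $\beta$-transformation is $T_\beta(x)=\beta x-\lfloor\beta x\rfloor$ for $x\in[0,1)$, extended by $T_\beta(1)=\beta-\lfloor\beta\rfloor$; $T_\beta^n$ is its $n$-th iterate ($T_\beta^0 x=x$). For a positive function $\psi_2:\mathbb{N}\to\mathbb{R}^+$ define $$\mathcal{U}(\psi_2)=\{x\in[0,1]: \text{for all sufficiently large integers } N \text{ there is an integer } n\in[0,N] \text{ with } T_\beta^n x<\psi_2(N)\},$$ $$\underline{v}_2=\liminf_{n\to\infty}\frac{-\log_\beta\psi_2(n)}{n},\qquad \overline{v}_2=\limsup_{n\to\infty}\frac{-\log_\beta\psi_2(n)}{n},$$ which may equal $+\infty$. $\dim_H$ denotes Hausdorff dimension. Convention: $\frac{1}{1+\overline{v}_2}=0$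 if $\overline{v}_2=\infty$. *)

(* Defs.v *)
From mathcomp Require Import all_boot all_order all_algebra.
From mathcomp Require Import all_classical all_reals all_analysis.
Import Order.TTheory GRing.Theory Num.Theory.
Import numFieldNormedType.Exports.

Set Implicit Arguments.
Unset Strict Implicit.
Unset Printing Implicit Defensive.

Local Open Scope classical_set_scope.
Local Open Scope ring_scope.

Section Hausdorff.
Context {R : realType}.
Implicit Types (A U : set R) (s delta : R).
Local Open Scope ereal_scope.

(* The point 0 is thrown in so that the empty set has diameter 0, and not
   sup set0 = -oo. *)
Definition diam U : \bar R :=
  ereal_sup (0 |` [set (`|x - y|%R)%:E | x in U & y in U]).

(* For s = 0 the library has 0 `^ 0 = 1, as wanted for a singleton; the empty
   set must still weigh 0, so that finite covers count as sequences. *)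
Definition hausdorff_weight s U : \bar R :=
  if U == set0 then 0 else diam U `^ s.

Definition hausdorff_content s delta A : \bar R :=
  ereal_inf [set \sum_(0 <= i <oo) hausdorff_weight s (U i) |
    U in [set U : (set R)^nat |
      A `<=` \bigcup_i U i /\ forall i, diam (U i) <= delta%:E]].

(* hausdorff_content is nonincreasing in delta, so the supremum is the limit
   as delta tends to 0 from the right. *)
Definition hausdorff_measure s A : \bar R :=
  ereal_sup [set hausdorff_content s delta A | delta in [set delta | (0 < delta)%R]].

Definition hausdorff_dim A : \bar R :=
  ereal_inf [set s%:E | s in [set s | (0 <= s)%R /\ hausdorff_measure s A = 0]].

End Hausdorff.

Section BetaTransformation.
Context {R : realType}.
Implicit Types (beta x : R) (psi : nat -> R).

(* Only used on [0, 1]; at x = 1 the formula gives beta - floor beta. *)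
Definition beta_transformation beta x : R :=
  beta * x - (Num.floor (beta * x))%:~R.

Definition uniform_set beta psi : set R :=
  [set x | 0 <= x <= 1 /\
    \forall N \near \oo,
      exists2 n, (n <= N)%N & iter n (beta_transformation beta) x < psi N].

(* - log_beta (psi n) / n; the junk value at n = 0 does not affect the lower
   and upper limits. *)
Definition log_rate beta psi (n : nat) : R :=
  - (ln (psi n) / ln beta) / n%:R.

Definition lower_rate beta psi : \bar R :=
  limn_einf (fun n => (log_rate beta psi n)%:E).

Definition upper_rate beta psi : \bar R :=
  limn_esup (fun n => (log_rate beta psi n)%:E).

End BetaTransformation.

(* Main.v *)
Require Import Defs.
From mathcomp Require Import all_boot all_order all_algebra.
From mathcomp Require Import all_classical all_reals all_analysis.
From mathcomp Require Import zify ring lra.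
Import Order.TTheory GRing.Theory Num.Theory.
Import numFieldNormedType.Exports.

(** Write theta(v) = ((1 - v) / (1 + v))^2. A small value of the n-th iterate of x
    means a block of zeros in the beta-expansion of x that starts at place n, and
    T^n x < beta^(-v N) with n <= N asks for a block of length about v N. So x is
    in the uniform set for psi N = beta^(-v N) when, at every large N, a block of
    zeros that starts before N is about as long as v N. Look at the blocks that
    are longer than all earlier ones, the k-th one occupying [n_k, m_k[: the
    condition becomes m_k - n_k >= v n_(k+1) ([record_sequence]).

    If v > 1, then n_(k+1) >= m_k bounds the length of the blocks. So the orbit
    reaches 0, which happens for countably many x ([uniform_set_countable]).

    If v < 1, let S_k be the number of zeros in the first k blocks. If zeros filled
    less than a fraction eta < 1 - theta(v) of the first m_k digits for all k, then
    S_(k+1) < eta m_(k+1), together with m_(k+1) <= (m_k - n_k) / v +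
    (m_(k+1) - n_(k+1)), would be a recurrence that makes the ratios S_(k+1) / S_k
    decrease by a fixed amount for ever; the threshold 1 - theta(v) is where the
    discriminant of a quadratic changes sign ([block_sums_absurd]). So infinitely
    often the first m digits contain at most (1 - eta) m that are not prescribed,
    and the admissible prefixes are about beta^((1 - eta) m) in number: blocks are
    long, so that their positions cost nothing ([zero_pattern_cover]), and there
    are at most C beta^n cylinders of order n ([size_left_endpoints_le]). Covering
    by intervals of length beta^-m gives the bound theta(lower rate) for the
    dimension ([uniform_set_null_liminf]). For 1 / (1 + upper rate) it is enough to
    cover at the infinitely many N where psi is small
    ([uniform_set_null_limsup]).

    For the lower bound the extremal sequence in the recurrence, in which n_k grows
    like (2 / (1 - v))^k, is turned into a Cantor set inside the uniform set: zeros
    on the blocks, free digits elsewhere ([zero_schedule]). To concatenate freely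
    for an arbitrary beta, the digits are left endpoints of full cylinders of one
    large order q, of which there are at least c gamma^q for any gamma < beta
    ([size_full_endpoints_ge]). The set is coded by [0, 1[ with a Holder
    inverse, and a cover of it then pulls back to a cover of [0, 1[, whose
    Lebesgue measure is 1 ([hausdorff_measure_holder_neq0],
    [uniform_set_hausdorff_neq0]). *)

Set Implicit Arguments.
Unset Strict Implicit.
Unset Printing Implicit Defensive.

(** * Bounds for Hausdorff measure *)

Section HausdorffEstimates.
Context {R : realType}.
Implicit Types (A E U : set R) (s a r delta : R).
Local Open Scope classical_set_scope.
Local Open Scope ring_scope.

Lemma geometric_sum_le (x : R) n : 0 <= x < 1 ->
  \sum_(0 <= i < n) x ^+ i <= (1 - x)^-1.
Proof.
move=> /andP[x0 x1]; have x1' : 0 < 1 - x by rewrite subr_gt0.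
have -> : \sum_(0 <= i < n) x ^+ i = (1 - x ^+ n) / (1 - x).
  have := congr1 (fun f => f n) (geometric_seriesE 1 (negbT (lt_eqF x1))).
  rewrite /series /geometric /= mul1r => <-.
  by apply: eq_bigr => k _; rewrite mul1r.
by rewrite ler_piMl ?invr_ge0 ?(ltW x1') // lerBlDr lerDl exprn_ge0.
Qed.

Lemma diam_ge0 U : (0 <= diam U)%E.
Proof. by apply: ereal_sup_ubound; left. Qed.

Lemma dist_le_diam U x y : U x -> U y -> (`|x - y|%:E <= diam U)%E.
Proof. by move=> Ux Uy; apply: ereal_sup_ubound; right; exists x => //; exists y. Qed.

Lemma diam_itv_le a r : 0 <= r -> (diam `[a, (a + r)%R]%classic <= r%:E)%E.
Proof.
move=> r0; apply: ge_ereal_sup => _ [->|[x + [y + <-]]]; first by rewrite lee_fin.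
rewrite /= !in_itv /= => /andP[? ?] /andP[? ?].
by rewrite lee_fin ler_norml; apply/andP; split; lra.
Qed.

Lemma hausdorff_weight_ge0 s U : (0 <= hausdorff_weight s U)%E.
Proof. by rewrite /hausdorff_weight; case: ifP => // _; exact: poweR_ge0. Qed.

Lemma hausdorff_weight_itv_le s a r : 0 <= s -> 0 <= r ->
  (hausdorff_weight s `[a, (a + r)%R]%classic <= (r `^ s)%:E)%E.
Proof.
move=> s0 r0; rewrite /hausdorff_weight; case: ifP => _.
  by rewrite lee_fin powR_ge0.
rewrite -poweR_EFin; apply: (gt0_ler_poweR s0).
- by rewrite in_itv /= diam_ge0 leey.
- by rewrite in_itv /= lee_fin r0 leey.
- exact: diam_itv_le.
Qed.

Lemma hausdorff_content_ge0 s delta A : (0 <= hausdorff_content s delta A)%E.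
Proof.
apply: le_ereal_inf_tmp => _ [U _ <-].
by apply: nneseries_ge0 => n _ _; exact: hausdorff_weight_ge0.
Qed.

Lemma hausdorff_measure_eq0 s A :
  (forall delta (e : R), 0 < delta -> 0 < e -> (hausdorff_content s delta A <= e%:E)%E) ->
  hausdorff_measure s A = 0%E.
Proof.
move=> small; apply/eqP; rewrite eq_le; apply/andP; split; last first.
  apply: le_trans (hausdorff_content_ge0 s 1 A) _.
  by apply: ereal_sup_ubound; exists 1 => //=.
apply: ge_ereal_sup => _ [d /= d0 <-].
by apply/lee_addgt0Pr => e e0; rewrite add0e; exact: small.
Qed.

Lemma hausdorff_dim_ge0 A : (0 <= hausdorff_dim A)%E.
Proof. by apply: le_ereal_inf_tmp => _ [s [s0 _] <-]; rewrite lee_fin. Qed.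

Lemma hausdorff_dim_le A (d d1 : R) : 0 <= d -> d < d1 ->
  (forall s, d < s < d1 -> hausdorff_measure s A = 0%E) ->
  (hausdorff_dim A <= d%:E)%E.
Proof.
move=> d0 dd1 null; apply/lee_addgt0Pr => e e0.
pose s := d + Num.min (e / 2) ((d1 - d) / 2).
have sd : d < s by rewrite /s ltrDl lt_min; apply/andP; split; lra.
have sd1 : s < d1.
  rewrite /s -ltrBrDl gt_min; apply/orP; right; lra.
have se : s <= d + e by rewrite /s lerD2l ge_min; apply/orP; left; lra.
apply: (@le_trans _ _ s%:E); last by rewrite -EFinD lee_fin.
apply: ereal_inf_lbound; exists s => //; split; first by rewrite ltW // (le_lt_trans d0).
by apply: null; rewrite sd sd1.
Qed.

Lemma hausdorff_dim_ge A (d : \bar R) :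
  (forall s, 0 <= s -> (s%:E < d)%E -> hausdorff_measure s A != 0%E) ->
  (d <= hausdorff_dim A)%E.
Proof.
move=> pos; apply: le_ereal_inf_tmp => _ [s [s0 sA] <-].
by rewrite leNgt; apply/negP => /(pos _ s0); rewrite sA eqxx.
Qed.

(** A pair [p] stands for the closed interval with endpoints [p.1] and
    [p.1 + p.2]. *)
Definition finite_cover (s delta b : R) (E : set R) :=
  exists l : seq (R * R),
    [/\ forall p, p \in l -> 0 <= p.2 <= delta,
        forall x, E x -> exists2 p, p \in l & p.1 <= x <= p.1 + p.2 &
        \sum_(p <- l) p.2 `^ s <= b].

(** The easy half of the Borel-Cantelli lemma: the covers of the [E m] with
    [m >= M] together cover the limsup of the [E m], at a total cost that is the
    tail of a geometric series. *)
Lemma hausdorff_measure_limsup_eq0 s (z K : R) (delta : nat -> R) (E : nat -> set R) A :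
  0 < s -> 0 <= z < 1 -> 0 <= K ->
  (forall e : R, 0 < e -> exists M, forall m, (M <= m)%N -> delta m <= e) ->
  (forall m, finite_cover s (delta m) (K * z ^+ m) (E m)) ->
  (forall x, A x -> forall M, exists2 m, (M <= m)%N & E m x) ->
  hausdorff_measure s A = 0%E.
Proof.
move=> s0 /andP[z0 z1] K0 dlim /choice[l lP] AE.
apply: hausdorff_measure_eq0 => d e d0 e0.
have z1' : 0 < 1 - z by rewrite subr_gt0.
have [M1 M1P] := dlim d d0.
have [M2 M2P] : exists M2, K * z ^+ M2 / (1 - z) <= e.
  have : (fun n => K * z ^+ n / (1 - z)) n @[n --> \oo] --> (K * 0 / (1 - z) : R).
    apply: cvgM; last exact: cvg_cst.
    by apply: cvgM; [exact: cvg_cst | apply: cvg_expr; rewrite ger0_norm].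
  rewrite mulr0 mul0r => /cvgrPdist_le /(_ e e0)[M _ MP].
  exists M; have := MP M (leqnn _).
  rewrite sub0r normrN ger0_norm // mulr_ge0 ?mulr_ge0 ?exprn_ge0 //.
  by rewrite invr_ge0 ltW.
pose M := maxn M1 M2.
(* The degenerate interval in front of each cover has weight 0, and ensures that
   the first n covers supply at least n intervals: so the i-th interval can be
   read in the concatenation of the first i + 1 covers. *)
pose l' m := (0, 0) :: l (M + m)%N : seq (R * R).
pose F n := flatten [seq l' m | m <- iota 0 n].
have FS n : F n.+1 = F n ++ l' n.
  by rewrite /F -addn1 iotaD map_cat flatten_cat /= cats0.
have sF n : (n <= size (F n))%N.
  elim: n => // n IH; rewrite FS size_cat /=; lia.
have stable n n' i : (n <= n')%N -> (i < size (F n))%N ->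
    nth (0, 0) (F n') i = nth (0, 0) (F n) i.
  move=> nn' i_n; have [t ->] : exists t, F n' = F n ++ t.
    elim: n' nn' => [|n' IH]; first by rewrite leqn0 => /eqP->; exists [::]; rewrite cats0.
    rewrite leq_eqVlt => /orP[/eqP->|]; first by exists [::]; rewrite cats0.
    by rewrite ltnS => /IH[t tE]; exists (t ++ l' n'); rewrite FS tE catA.
  by rewrite nth_cat i_n.
have memF n p : p \in F n -> exists2 m, (m < n)%N & p \in l' m.
  elim: n => // n IH; rewrite FS mem_cat => /orP[/IH[m mn pm]|pn].
    by exists m => //; exact: ltnW.
  by exists n.
have l'P m p : p \in l' m -> 0 <= p.2 <= d.
  rewrite inE => /orP[/eqP->/=|]; first by rewrite lexx ltW.
  have [dP _ _] := lP (M + m)%N; move=> /dP /andP[-> /le_trans]; apply.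
  by apply: M1P; rewrite (leq_trans _ (leq_addr _ _)) // leq_maxl.
pose p_ i := nth (0, 0) (F i.+1) i.
have p_P i : 0 <= (p_ i).2 <= d.
  have : p_ i \in F i.+1 by apply: mem_nth; exact: sF.
  by move=> /memF[m _]; exact: l'P.
pose U i : set R := `[(p_ i).1, (p_ i).1 + (p_ i).2]%classic.
apply: (@le_trans _ _ (\sum_(0 <= i <oo) hausdorff_weight s (U i))%E).
  apply: ereal_inf_lbound; exists U => //; split.
    move=> x /AE/(_ M)[m Mm Em].
    have [_ cov _] := lP m.
    have [p pl xp] := cov _ Em.
    have pF : p \in F (m - M).+1.
      by rewrite FS mem_cat /l' subnKC // inE pl !orbT.
    set i := index p (F (m - M).+1).
    exists i => //; rewrite /U /= in_itv /=.
    suff -> : p_ i = p by [].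
    rewrite -[RHS](nth_index (0, 0) pF) -/i /p_.
    have iF : (i < size (F (m - M).+1))%N by rewrite index_mem.
    by have [le|/ltnW le] := leqP i.+1 (m - M).+1;
      [rewrite (stable _ _ _ le)|rewrite -(stable _ _ _ le)].
  move=> i; have /andP[p0 pd] := p_P i.
  by apply: (le_trans (diam_itv_le _ p0)); rewrite lee_fin.
apply: lime_le; first by apply: is_cvg_nneseries => *; exact: hausdorff_weight_ge0.
apply: nearW => n.
apply: (@le_trans _ _ (\sum_(0 <= i < n) ((p_ i).2 `^ s)%:E)%E).
  apply: lee_sum => i _; apply: hausdorff_weight_itv_le; first exact: ltW.
  by have /andP[] := p_P i.
rewrite sumEFin lee_fin.
have -> : \sum_(0 <= i < n) (p_ i).2 `^ s = \sum_(0 <= i < n) (nth (0, 0) (F n) i).2 `^ s.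
  by apply: eq_big_nat => i /andP[_ i_n]; rewrite /p_ (stable _ _ _ i_n) ?sF.
apply: (@le_trans _ _ (\sum_(p <- F n) p.2 `^ s)).
  rewrite [leRHS](big_nth (0, 0)) (big_cat_nat (leq0n n) (sF n)) /= lerDl.
  by apply: sumr_ge0 => i _; exact: powR_ge0.
apply: (@le_trans _ _ (\sum_(0 <= m < n) K * z ^+ (M + m))).
  elim: n => [|n IH]; first by rewrite !big_nil.
  rewrite FS big_cat big_nat_recr //= lerD // big_cons /= powR0 ?gt_eqF // add0r.
  by have [_ _] := lP (M + n)%N.
apply: (@le_trans _ _ (K * z ^+ M2 / (1 - z))); last exact: M2P.
under eq_bigr do rewrite exprD mulrA.
rewrite -mulr_sumr; apply: ler_pM.
- by rewrite mulr_ge0 ?exprn_ge0.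
- by apply: sumr_ge0 => *; exact: exprn_ge0.
- apply: ler_wpM2l => //; apply: ler_wiXn2l => //; [exact: ltW | exact: leq_maxr].
- by apply: geometric_sum_le; rewrite z0.
Qed.

(** This plays the part of the mass distribution principle without a measure on
    [A]: the preimages under [g] of a cover of [A] cover [0, 1[, and each of them
    lies in an interval whose length is comparable to the weight of the covering
    set. Hence the total weight is at least a constant multiple of the Lebesgue
    measure of [0, 1[. *)
Lemma hausdorff_measure_holder_neq0 s (C : R) A (g : R -> R) :
  0 <= s -> 0 < C ->
  (forall y, 0 <= y < 1 -> A (g y)) ->
  (forall y y', 0 <= y < 1 -> 0 <= y' < 1 -> `|y - y'| <= C * `|g y - g y'| `^ s) ->
  hausdorff_measure s A != 0%E.
Proof.
move=> s0 C0 gA gC; apply/eqP => HA.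
have C20 : 0 < 2 * C by rewrite mulr_gt0.
have : (hausdorff_content s 1 A < (2 * C)^-1%:E)%E.
  apply: (@le_lt_trans _ _ 0%E); last by rewrite lte_fin invr_gt0.
  by rewrite -HA; apply: ereal_sup_ubound; exists 1 => //=.
move=> /ereal_inf_lt[_ [U [AU dU] <-]].
have /choice[J JP] (i : nat) : exists J : set R,
    [/\ measurable J, (forall y, 0 <= y < 1 -> U i (g y) -> J y) &
     (lebesgue_measure J <= (2 * C)%:E * hausdorff_weight s (U i))%E].
  have [[y0 [y001 Uy0]]|no] := pselect (exists y, 0 <= y < 1 /\ U i (g y)); last first.
    exists set0; split=> //; first by move=> y y01 Uy; case: no; exists y.
    by rewrite measure0 mule_ge0 ?lee_fin ?(ltW C20) // hausdorff_weight_ge0.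
  have dfin : diam (U i) \is a fin_num.
    by rewrite ge0_fin_numE ?diam_ge0 // (le_lt_trans (dU i)) // ltry.
  pose r := fine (diam (U i)) `^ s.
  have r0 : 0 <= r by exact: powR_ge0.
  have wE : hausdorff_weight s (U i) = r%:E.
    rewrite /hausdorff_weight ifF; last by apply/negP => /eqP U0; move: Uy0; rewrite U0.
    by rewrite /r -poweR_EFin fineK.
  exists `[y0 - C * r, y0 + C * r]%classic; split.
  - exact: measurable_itv.
  - move=> y y01 Uy; rewrite /= in_itv /=.
    have : `|y - y0| <= C * r.
      apply: le_trans (gC _ _ y01 y001) _; apply: ler_wpM2l; first exact: ltW.
      apply: ge0_ler_powR => //; rewrite ?nnegrE ?fine_ge0 ?diam_ge0 //.
      by rewrite -lee_fin fineK //; exact: dist_le_diam.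
    by rewrite ler_norml => /andP[? ?]; apply/andP; split; lra.
  - rewrite lebesgue_measure_itv /= lte_fin wE -EFinM; case: ifPn => _.
      by rewrite -EFinB lee_fin; nra.
    by rewrite lee_fin; nra.
move=> small.
have : (lebesgue_measure (`[0%R, 1%R[%classic : set R) <=
    \sum_(0 <= i <oo) lebesgue_measure (J i))%E.
  apply: measure_sigma_subadditive => [i||y]; [by have [] := JP i|exact: measurable_itv|].
  rewrite /= in_itv /= => y01; have [i _ Ui] := AU _ (gA _ y01).
  by exists i => //; have [_ JU _] := JP i; exact: JU.
rewrite lebesgue_measure_itv /= lte_fin ltr01 sube0.
apply/negP; rewrite -ltNge.
apply: (@le_lt_trans _ _ (\sum_(0 <= i <oo) (2 * C)%:E * hausdorff_weight s (U i)))%E.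
  by apply: lee_nneseries => [i _|i _]; [by []|by have [] := JP i].
rewrite nneseriesZl; last by move=> *; exact: hausdorff_weight_ge0.
by rewrite -lte_pdivlMl // mule1.
Qed.

End HausdorffEstimates.

(** * Cylinders of the beta-transformation *)

Section Cylinders.
Local Open Scope classical_set_scope.
Local Open Scope ring_scope.
Context {R : realType} (beta : R) (beta1 : 1 < beta).
Implicit Types (x y t a : R) (n : nat).
Local Notation T := (beta_transformation beta).

Lemma base_gt0 : 0 < beta. Proof. exact: lt_trans beta1. Qed.

Lemma base_exp_gt0 n : 0 < beta ^+ n. Proof. exact/exprn_gt0/base_gt0. Qed.

Lemma base_ge0 : 0 <= beta. Proof. exact/ltW/base_gt0. Qed.

Lemma base_exp_ge0 n : 0 <= beta ^+ n. Proof. exact/ltW/base_exp_gt0. Qed.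

Local Hint Resolve base_gt0 base_exp_gt0 base_ge0 base_exp_ge0 : core.

Lemma beta_transformation_itv x : 0 <= T x < 1.
Proof.
rewrite /beta_transformation subr_ge0 floor_le /=.
by rewrite ltrBlDl -(intrD1 (Num.floor _)) floorD1_gt.
Qed.

Lemma iter_beta_transformation_itv n x : 0 <= x < 1 -> 0 <= iter n T x < 1.
Proof. by case: n => // n _; rewrite iterS; exact: beta_transformation_itv. Qed.

(** Any natural digit [d] is read off exactly, even one exceeding beta: no
    admissibility is involved at this level. *)
Lemma beta_transformation_digit d y : 0 <= y < 1 -> T ((d%:R + y) / beta) = y.
Proof.
move=> y01; rewrite /beta_transformation mulrC divfK ?gt_eqF //.
have -> : Num.floor (d%:R + y) = d%:Z :> int.
  apply: floor_def; rewrite intrD -!pmulrn; lra.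
by rewrite -pmulrn addrC addKr.
Qed.

Lemma beta_transformation_small x : 0 <= beta * x < 1 -> T x = beta * x.
Proof.
move=> x01; have -> : x = (0%:R + beta * x) / beta by rewrite add0r mulrC mulKf ?gt_eqF.
by rewrite beta_transformation_digit // add0r [RHS]mulrC divfK ?gt_eqF.
Qed.

Lemma iter_beta_transformation_small n x : 0 <= x -> beta ^+ n * x < 1 ->
  iter n T x = beta ^+ n * x.
Proof.
move=> x0; elim: n => [|n IH] lt1; first by rewrite expr0 mul1r.
have le : beta ^+ n * x <= beta ^+ n.+1 * x.
  by apply: ler_wpM2r => //; rewrite exprS ler_peMl ?ltW.
rewrite iterS IH ?(le_lt_trans le) // exprS -mulrA.
by rewrite beta_transformation_small // mulrA -exprS lt1 andbT mulr_ge0.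
Qed.

(** Digit and remainder of the quasi-greedy expansion: rounding up keeps the
    remainder in ]0, 1], so that an interval [0, t[ is always left with a
    nonempty last piece. *)
Definition quasi_digit t : nat := `|Num.ceil (beta * t) - 1|%N.
Definition quasi_rem t : R := beta * t - (quasi_digit t)%:R.

Lemma quasi_rem_itv t : 0 < t -> 0 < quasi_rem t <= 1.
Proof.
move=> t0; rewrite /quasi_rem /quasi_digit.
have /andP[lt le] := ceil_itv (beta * t).
have : 0 <= Num.ceil (beta * t) - 1 by rewrite subr_ge0 -gtz0_ge1 ceil_gt0 mulr_gt0.
move=> d0; have -> : (`|Num.ceil (beta * t) - 1|%N)%:R = (Num.ceil (beta * t) - 1)%:~R :> R.
  by rewrite pmulrn gez0_abs.
rewrite subr_gt0 lt /= intrB; lra.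
Qed.

(** The map sends [0, t[ onto [quasi_digit t] copies of [0, 1[ followed by
    [0, quasi_rem t[. Iterating this n times cuts [0, t[ into pieces that
    are mapped onto intervals [0, t'[; the list consists of the left endpoints of
    those with [keep t']. Thus [predT] gives all cylinders of order n and [pred1 1]
    the full ones. *)
Fixpoint cylinders (keep : pred R) n t : seq R :=
  if n is n'.+1 then
    [seq (d%:R + y) / beta | d <- iota 0 (quasi_digit t), y <- cylinders keep n' 1] ++
    [seq ((quasi_digit t)%:R + y) / beta | y <- cylinders keep n' (quasi_rem t)]
  else if keep t then [:: 0] else [::].

Lemma size_cylindersS keep n t :
  size (cylinders keep n.+1 t) =
  (quasi_digit t * size (cylinders keep n 1%R) + size (cylinders keep n (quasi_rem t)))%N.
Proof. by rewrite /= size_cat size_allpairs size_iota size_map. Qed.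

Local Notation left_endpoints := (cylinders predT).
Local Notation full_endpoints := (cylinders (pred1 1)).

Lemma left_endpoints_cover n t x : 0 < t <= 1 -> 0 <= x < t ->
  exists2 a, a \in left_endpoints n t & x = a + iter n T x / beta ^+ n.
Proof.
elim: n t x => [|n IH] t x /andP[t0 t1] /andP[x0 xt].
  by exists 0; rewrite ?mem_head //= expr0 divr1 add0r.
have /andP[r0 r1] := quasi_rem_itv t0.
have /andP[Tx0 Tx1] := beta_transformation_itv x.
pose d := `|Num.floor (beta * x)|%N.
have xE : x = (d%:R + T x) / beta.
  rewrite /d /beta_transformation pmulrn gez0_abs ?floor_ge0 ?mulr_ge0 //.
  by rewrite addrC subrK mulrC mulKf ?gt_eqF.
have bx : beta * x = d%:R + T x by rewrite [in LHS]xE mulrC divfK ?gt_eqF.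
have bt : beta * t = (quasi_digit t)%:R + quasi_rem t by rewrite /quasi_rem addrC subrK.
have bxt : beta * x < beta * t by rewrite ltr_pM2l.
have step a : T x = a + iter n T (T x) / beta ^+ n ->
    x = (d%:R + a) / beta + iter n.+1 T x / beta ^+ n.+1.
  move=> E; rewrite iterSr [LHS]xE [in LHS]E exprS invfM !mulrDl !addrA.
  by rewrite -[_ / _ / _]mulrA [_^-1 * _^-1]mulrC.
have [dlt|] := ltnP d (quasi_digit t).
  have [|a aL aE] := IH 1 (T x) _ (beta_transformation_itv x); first by rewrite ltr01 lexx.
  exists ((d%:R + a) / beta); last exact: step.
  rewrite /= mem_cat; apply/orP; left.
  by apply/allpairsP; exists (d, a); rewrite mem_iota.
rewrite leq_eqVlt => /orP[/eqP deq|dgt]; last first.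
  have : (quasi_digit t).+1%:R <= d%:R :> R by rewrite ler_nat.
  by rewrite -natr1; lra.
have [||a aL aE] := IH (quasi_rem t) (T x).
- by rewrite r0.
- by rewrite Tx0 /=; move: bt bx; rewrite -deq; lra.
exists ((d%:R + a) / beta); last exact: step.
by rewrite /= mem_cat -deq; apply/orP; right; apply/mapP; exists a.
Qed.

(** Renyi's bound. On [0, t[ the count is at most 1 + beta^n t b_n, where b_n is
    the partial sum of the series of beta^-i: the branches of [0, t[ have total
    length beta t, and the error term 1 of the full branches, which is beta^-n
    relative to beta^n, goes into b_(n+1). *)
Lemma size_left_endpoints_le n :
  (size (left_endpoints n 1))%:R <= beta / (beta - 1) * beta ^+ n.
Proof.
pose b n : R := \sum_(0 <= i < n) (beta^-1) ^+ i.
have b0 m : 0 <= b m by apply: sumr_ge0 => *; rewrite exprn_ge0 // invr_ge0 ltW.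
have bnd m t : 0 < t <= 1 ->
    (size (left_endpoints m t))%:R <= 1 + beta ^+ m * t * b m.
  elim: m t => [|m IH] t /andP[t0 t1]; first by rewrite /= /b big_nil mulr0 addr0.
  have /andP[r0 r1] := quasi_rem_itv t0.
  rewrite size_cylindersS natrD natrM.
  have h1 := IH 1 _; have {h1} := h1 ltac:(by rewrite ltr01 lexx).
  have := IH (quasi_rem t) ltac:(by rewrite r0).
  have bS : b m.+1 = b m + (beta ^+ m)^-1 by rewrite /b big_nat_recr //= exprVn.
  rewrite mulr1 => h2 h1.
  have h3 : (size (left_endpoints m 1))%:R <= beta ^+ m * b m.+1.
    by rewrite bS mulrDr divff ?gt_eqF // addrC.
  have h4 : 1 + beta ^+ m * quasi_rem t * b m <= 1 + beta ^+ m * quasi_rem t * b m.+1.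
    by rewrite lerD2l bS ler_wpM2l ?lerDl ?invr_ge0 // mulr_ge0 // ltW.
  have dE : beta * t = (quasi_digit t)%:R + quasi_rem t by rewrite /quasi_rem addrC subrK.
  rewrite (_ : 1 + beta ^+ m.+1 * t * b m.+1 =
     (quasi_digit t)%:R * (beta ^+ m * b m.+1) +
     (1 + beta ^+ m * quasi_rem t * b m.+1)); last first.
    have -> : beta ^+ m.+1 * t = beta ^+ m * (beta * t) by rewrite exprS; ring.
    by rewrite dE; ring.
  by apply: lerD; [apply: ler_wpM2l | apply: le_trans h4].
have := bnd n 1; rewrite ltr01 lexx => /(_ isT).
move=> /le_trans; apply.
have -> : 1 + beta ^+ n * 1 * b n = b n.+1 * beta ^+ n.
  rewrite mulr1 /b big_nat_recr //= exprVn mulrDl mulVf ?gt_eqF //; ring.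
rewrite ler_pM2r //.
have -> : beta / (beta - 1) = (1 - beta^-1)^-1.
  have b1 : beta - 1 != 0 by rewrite subr_eq0 gt_eqF.
  field; rewrite b1 gt_eqF //.
by apply: geometric_sum_le; rewrite invr_ge0 ltW //= invf_lt1.
Qed.

Lemma full_endpointsP n t a : 0 < t <= 1 -> a \in full_endpoints n t ->
  [/\ 0 <= a, a + (beta ^+ n)^-1 <= t &
      forall y, 0 <= y < 1 -> iter n T (a + y / beta ^+ n) = y].
Proof.
elim: n t a => [|n IH] t a /andP[t0 t1].
  rewrite /=; case: eqP => // -> /[!inE] /eqP->; rewrite expr0 invr1 add0r.
  by split => // y _; rewrite mulr1 add0r.
have /andP[r0 r1] := quasi_rem_itv t0.
have dE : beta * t = (quasi_digit t)%:R + quasi_rem t by rewrite /quasi_rem addrC subrK.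
have step (d : nat) t' b : 0 < t' <= 1 -> d%:R + t' <= beta * t -> b \in full_endpoints n t' ->
   [/\ 0 <= (d%:R + b) / beta, (d%:R + b) / beta + (beta ^+ n.+1)^-1 <= t &
      forall y, 0 <= y < 1 -> iter n.+1 T ((d%:R + b) / beta + y / beta ^+ n.+1) = y].
  move=> t'01 dt' /(IH _ _ t'01)[b0 bt' bT]; split.
  - by rewrite divr_ge0 ?addr_ge0 // ltW.
  - have -> : (d%:R + b) / beta + (beta ^+ n.+1)^-1 = (d%:R + (b + (beta ^+ n)^-1)) / beta.
      by rewrite exprS invfM; ring.
    by rewrite ler_pdivrMr // [t * _]mulrC; apply: le_trans dt'; rewrite lerD2l.
  - move=> y y01; rewrite iterSr -[RHS](bT y y01); congr (iter _ _ _).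
    have -> : (d%:R + b) / beta + y / beta ^+ n.+1 = (d%:R + (b + y / beta ^+ n)) / beta.
      by rewrite exprS invfM; ring.
    rewrite beta_transformation_digit //.
    move: y01 t'01 => /andP[y0 y1] /andP[_ t'1]; rewrite addr_ge0 ?divr_ge0 //=.
    apply: lt_le_trans (le_trans bt' t'1).
    by rewrite ltrD2l ltr_pdivrMr // mulVf ?gt_eqF.
rewrite /= mem_cat => /orP[/allpairsP[[d b] /= [dI bF ->]]|/mapP[b bF ->]]; last first.
  by apply: step bF; rewrite ?r0 ?dE.
apply: step bF; first by rewrite ltr01 lexx.
move: dI; rewrite mem_iota /= add0n => dI.
have : d.+1%:R <= (quasi_digit t)%:R :> R by rewrite ler_nat.
by rewrite -natr1; lra.
Qed.

Lemma full_endpoints_uniq n t : 0 < t <= 1 -> uniq (full_endpoints n t).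
Proof.
have t1 : 0 < (1 : R) <= 1 by rewrite ltr01 lexx.
elim: n t => [|n IH] t; first by rewrite /=; case: eqP.
move=> /andP[t0 _]; have /andP[r0 r1] := quasi_rem_itv t0.
have r01 : 0 < quasi_rem t <= 1 by rewrite r0.
have lt1 b t' : 0 < t' <= 1 -> b \in full_endpoints n t' -> 0 <= b < 1.
  move=> t'01 /(full_endpointsP t'01)[-> bt' _] /=; move: t'01 => /andP[_ t'1].
  by apply: lt_le_trans (le_trans bt' t'1); rewrite ltrDl invr_gt0.
have inj (d d' : nat) b b' : 0 <= b < 1 -> 0 <= b' < 1 ->
    (d%:R + b) / beta = (d'%:R + b') / beta -> d = d' /\ b = b'.
  move=> b01 b'01 E; have bb' : b = b'.
    by rewrite -(beta_transformation_digit d b01) E beta_transformation_digit.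
  split=> //; apply/eqP; rewrite -(eqr_nat R); apply/eqP/(@addIr _ b').
  have ib : beta^-1 != 0 by rewrite invr_eq0 gt_eqF.
  by apply: (mulIf ib); rewrite -E bb'.
rewrite /= cat_uniq; apply/and3P; split.
- apply: allpairs_uniq; [exact: iota_uniq | exact: IH|].
  move=> [d b] [d' b'] /allpairsP[[? ?] /= [_ bF [-> ->]]] /allpairsP[[? ?] /= [_ b'F [-> ->]]].
  by rewrite /uncurry /= => /(inj _ _ _ _ (lt1 _ _ t1 bF) (lt1 _ _ t1 b'F))[-> ->].
- apply/hasPn => _ /mapP[b bF ->]; apply/negP => /allpairsP[[d' b'] /= [dI b'F]].
  move=> /(inj _ _ _ _ (lt1 _ _ r01 bF) (lt1 _ _ t1 b'F))[dd' _].
  by move: dI; rewrite mem_iota -dd' /= add0n ltnn.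
- rewrite map_inj_in_uniq ?IH // => b b' bF b'F.
  by move=> /(inj _ _ _ _ (lt1 _ _ r01 bF) (lt1 _ _ r01 b'F))[].
Qed.

(** If [a'] fell strictly inside the cylinder of [a], the n-th iterate of [a'] would be both
    0 and the positive relative position of [a'] in that cylinder. *)
Lemma full_endpoints_separated n a a' :
  a \in full_endpoints n 1 -> a' \in full_endpoints n 1 -> a != a' ->
  (beta ^+ n)^-1 <= `|a - a'|.
Proof.
have t1 : 0 < (1 : R) <= 1 by rewrite ltr01 lexx.
wlog lt : a a' / a < a'.
  move=> W aF a'F ne; have := ne; rewrite neq_lt => /orP[lt|lt]; first exact: W.
  by rewrite distrC; apply: W => //; rewrite eq_sym.
move=> /(full_endpointsP t1)[a0 _ aT] /(full_endpointsP t1)[a'0 _ a'T] _.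
rewrite distrC gtr0_norm ?subr_gt0 // leNgt; apply/negP => close.
have y01 : 0 <= (a' - a) * beta ^+ n < 1.
  rewrite mulr_ge0 ?subr_ge0 ?(ltW lt) ?(ltW (base_exp_gt0 _)) //=.
  by rewrite -ltr_pdivlMr // div1r.
have := aT _ y01; rewrite mulfK ?gt_eqF // addrC subrK.
have := a'T 0; rewrite lexx ltr01 mul0r addr0 => /(_ isT) -> /esym/eqP.
by rewrite mulf_eq0 subr_eq0 !gt_eqF.
Qed.

(** The number F_n of full cylinders satisfies the renewal equation
    F_n = d_1 F_(n-1) + d_2 F_(n-2) + ..., in which the d_k are the quasi-greedy
    digits of 1, hence d_1 / beta + d_2 / beta^2 + ... = 1. With gamma < beta in
    place of beta the sum exceeds 1, and it does so already for its first [K]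
    terms; then c gamma^n <= F_n propagates from n < K to all n. *)
Lemma size_full_endpoints_ge (gamma : R) : 1 <= gamma < beta ->
  exists2 c, 0 < c & forall n, c * gamma ^+ n <= (size (full_endpoints n 1))%:R.
Proof.
move=> /andP[g1 gb]; have g0 : 0 < gamma by exact: lt_le_trans g1.
have [K K0 KP] : exists2 K, (0 < K)%N & gamma / beta <= 1 - (beta^-1) ^+ K.
  have : (fun n => (beta^-1) ^+ n) n @[n --> \oo] --> (0 : R).
    by apply: cvg_expr; rewrite ger0_norm ?invr_ge0 ?(ltW base_gt0) // invf_lt1.
  have e0 : 0 < 1 - gamma / beta by rewrite subr_gt0 ltr_pdivrMr // mul1r.
  move=> /cvgrPdist_le /(_ _ e0)[M _ MP].
  exists M.+1 => //; have := MP M.+1 (leqnSn _).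
  rewrite sub0r normrN ger0_norm ?exprn_ge0 ?invr_ge0 ?(ltW base_gt0) //; lra.
have d1 : (0 < quasi_digit 1)%N.
  have := quasi_rem_itv ltr01; rewrite /quasi_rem mulr1 lt0n => /andP[_ r1].
  by apply/eqP => d0; move: r1; rewrite d0 subr0 leNgt beta1.
have F1 n : (1 <= size (full_endpoints n 1))%N.
  elim: n => [|n IH]; first by rewrite /= eqxx.
  rewrite size_cylindersS; apply: leq_trans (leq_addr _ _).
  by rewrite muln_gt0 d1.
exists (gamma ^- K) => [|n]; first by rewrite invr_gt0 exprn_gt0.
set c := gamma ^- K; have c0 : 0 < c by rewrite invr_gt0 exprn_gt0.
elim/ltn_ind: n => n IH.
have [nK|Kn] := ltnP n K.
  apply: (@le_trans _ _ 1); last by rewrite ler1n.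
  by rewrite ler_pdivrMl ?exprn_gt0 // mulr1 ler_weXn2l // ltnW.
have rec j t m : (j <= m <= n)%N -> (j > 0)%N || (m < n)%N -> 0 < t <= 1 ->
    c * gamma ^+ m * ((if (j > 0)%N then beta / gamma else 1) * (t - (beta^-1) ^+ j))
      <= (size (full_endpoints m t))%:R.
  elim: j t m => [|j IHj] t m /andP[jm mn] _ /andP[t0 t1].
    rewrite expr0 mul1r; apply: (@le_trans _ _ 0) => //.
    by rewrite mulr_ge0_le0 ?subr_le0 // mulr_ge0 ?exprn_ge0 ?ltW.
  case: m jm mn => // m jm mn /=.
  have /andP[r0 r1] := quasi_rem_itv t0.
  have dE : beta * t = (quasi_digit t)%:R + quasi_rem t by rewrite /quasi_rem addrC subrK.
  rewrite size_cylindersS natrD natrM.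
  have h1 : c * gamma ^+ m * (quasi_rem t - (beta^-1) ^+ j)
      <= (size (full_endpoints m (quasi_rem t)))%:R.
    have := IHj (quasi_rem t) m; rewrite (jm : (j <= m)%N) (ltnW mn) orbC mn r0 r1.
    move=> /(_ isT isT isT); case: ltnP => _; last by rewrite mul1r.
    have [pos|neg] := lerP 0 (quasi_rem t - (beta^-1) ^+ j); last first.
      move=> _; apply: (@le_trans _ _ 0) => //.
      by rewrite mulr_ge0_le0 ?mulr_ge0 ?exprn_ge0 ?(ltW g0) ?(ltW c0) ?(ltW neg).
    apply: le_trans; apply: ler_wpM2l; first by rewrite mulr_ge0 ?exprn_ge0 ?(ltW g0) ?(ltW c0).
    by rewrite ler_peMl // ler_pdivlMr // mul1r ltW.
  have h2 : (quasi_digit t)%:R * (c * gamma ^+ m) <=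
      (quasi_digit t)%:R * (size (full_endpoints m 1))%:R.
    by rewrite ler_wpM2l // IH.
  apply: le_trans (lerD h2 h1).
  rewrite le_eqVlt; apply/orP; left; apply/eqP.
  rewrite [LHS](_ : _ = c * gamma ^+ m * (beta * t - beta * (beta^-1) ^+ j.+1)); last first.
    rewrite exprS; field; rewrite gt_eqF //.
  have -> : beta * (beta^-1) ^+ j.+1 = (beta^-1) ^+ j by rewrite exprS mulrA divff ?mul1r ?gt_eqF.
  rewrite dE; ring.
have := rec K 1 n; rewrite Kn leqnn K0 ltr01 lexx => /(_ isT isT isT).
apply: le_trans; rewrite ler_peMr ?mulr_ge0 ?exprn_ge0 ?(ltW g0) ?(ltW c0) //.
by rewrite mulrC -ler_pdivrMr ?divr_gt0 // invf_div mul1r.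
Qed.

End Cylinders.

Notation left_endpoints beta := (cylinders beta predT).
Notation full_endpoints beta := (cylinders beta (pred1 1%R)).

(** * Covers of prefixes with prescribed zeros *)

Section FiniteCovers.
Local Open Scope classical_set_scope.
Local Open Scope ring_scope.
Context {R : realType}.
Implicit Types (s delta b x a : R) (E : set R).

Lemma finite_cover_le s delta delta' b b' E : delta <= delta' -> b <= b' ->
  finite_cover s delta b E -> finite_cover s delta' b' E.
Proof.
move=> dd bb [l [ld lE lb]]; exists l; split=> //; last exact: le_trans lb bb.
by move=> p /ld /andP[-> /le_trans]; exact.
Qed.

Lemma finite_cover0 s delta : finite_cover s delta 0 set0.
Proof. by exists [::]; split=> //; rewrite big_nil. Qed.

Lemma finite_cover_itv s a r : 0 <= r -> finite_cover s r (r `^ s) `[a, a + r].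
Proof.
move=> r0; exists [:: (a, r)]; split.
- by move=> p /[!inE] /eqP -> /=; rewrite r0 lexx.
- by move=> x; rewrite /= in_itv => /= ax; exists (a, r); rewrite ?mem_head.
- by rewrite big_seq1.
Qed.

Lemma finite_coverU s delta b b' E E' :
  finite_cover s delta b E -> finite_cover s delta b' E' ->
  finite_cover s delta (b + b') (E `|` E').
Proof.
move=> [l [ld lE lb]] [l' [l'd l'E l'b]]; exists (l ++ l'); split.
- by move=> p; rewrite mem_cat => /orP[/ld|/l'd].
- by move=> x [/lE|/l'E][p pl xp]; exists p; rewrite // mem_cat pl ?orbT.
- by rewrite big_cat lerD.
Qed.

Lemma finite_cover_bigcup s delta n (b : nat -> R) (F : nat -> set R) E :
  (forall i, (i < n)%N -> finite_cover s delta (b i) (F i)) ->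
  (forall x, E x -> exists2 i, (i < n)%N & F i x) ->
  finite_cover s delta (\sum_(0 <= i < n) b i) E.
Proof.
elim: n E => [|n IH] E Fb EF.
  rewrite big_nil; have -> : E = set0 by apply/seteqP; split=> // x /EF[].
  exact: finite_cover0.
rewrite big_nat_recr //=.
have -> : E = E `&` [set x | exists2 i, (i < n)%N & F i x] `|` E `&` F n.
  apply/seteqP; split=> [x Ex|x []]; last by move=> [].
    have [i] := EF _ Ex; rewrite ltnS leq_eqVlt => /orP[/eqP->|i_n] Fx; first by right.
    by left; split=> //; exists i.
  by move=> [].
apply: finite_coverU.
  by apply: IH => [i i_n|x [_ //]]; apply: Fb; exact: ltnW.
have [l [ld lE lb]] := Fb n (ltnSn n).
by exists l; split=> // x [_ /lE].
Qed.

End FiniteCovers.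

Section Pullback.
Local Open Scope classical_set_scope.
Local Open Scope ring_scope.
Context {R : realType} (beta : R) (beta1 : 1 < beta) (s : R).
Implicit Types (delta b x a : R) (E : set R) (m f r l : nat).
Local Notation T := (beta_transformation beta).
Local Notation C := (beta / (beta - 1)).
Local Notation w := (beta `^ (- s)).
Local Hint Resolve base_gt0 base_exp_gt0 base_ge0 base_exp_ge0 : core.

Lemma powR_div_base_exp (r : R) l : 0 <= r -> (r / beta ^+ l) `^ s = w ^+ l * r `^ s.
Proof.
move=> r0; rewrite powRM ?invr_ge0 ?(base_exp_ge0 beta1) // mulrC; congr (_ * _).
have -> : (beta ^+ l)^-1 = beta `^ (- l%:R) by rewrite powRN powR_mulrn ?(base_ge0 beta1).
by rewrite -(powR_mulrn l (powR_ge0 beta (- s))) -!powRrM mulNr mulrC -mulNr.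
Qed.

Lemma finite_cover_scale l delta b E x0 : finite_cover s delta b E ->
  finite_cover s (delta / beta ^+ l) (w ^+ l * b) [set x0 + x / beta ^+ l | x in E].
Proof.
have ib : 0 < (beta ^+ l)^-1 by rewrite invr_gt0 base_exp_gt0.
move=> [c [cd cE cb]]; exists [seq (x0 + p.1 / beta ^+ l, p.2 / beta ^+ l) | p <- c]; split.
- move=> _ /mapP[p /cd /andP[p0 pd] ->] /=.
  by rewrite mulr_ge0 ?ler_pM2r ?(ltW ib).
- move=> _ [x /cE[p pc /andP[x1 x2]] <-].
  exists (x0 + p.1 / beta ^+ l, p.2 / beta ^+ l) => /=; first exact: (map_f _ pc).
  by rewrite lerD2l -addrA lerD2l -mulrDl !ler_pM2r // x1.
- rewrite big_map /=.
  apply: le_trans (_ : \sum_(p <- c) w ^+ l * p.2 `^ s <= _).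
    rewrite big_seq [leRHS]big_seq; apply: ler_sum => p /cd /andP[p0 _].
    by rewrite powR_div_base_exp.
  by rewrite -mulr_sumr ler_wpM2l // exprn_ge0 // powR_ge0.
Qed.

(** While the digits are 0 the map is multiplication by beta: a block of zeros
    contracts without branching. *)
Lemma finite_cover_block l delta b E : finite_cover s delta b E ->
  finite_cover s (delta / beta ^+ l) (w ^+ l * b)
    [set x | iter l T x = beta ^+ l * x /\ E (iter l T x)].
Proof.
move=> /(finite_cover_scale l 0)[c [cd cE cb]]; exists c; split=> // x [xl Ex].
apply: cE; exists (iter l T x) => //.
by rewrite xl add0r mulrC mulKf // gt_eqF ?(base_exp_gt0 beta1).
Qed.

(** A cylinder of order r is mapped by beta^r times a translation, so that its
    part of the preimage is a copy of a part of [E] scaled by beta^-r; and there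
    are at most C beta^r cylinders. *)
Lemma finite_cover_preimage r delta b E : finite_cover s delta b E ->
  finite_cover s (delta / beta ^+ r) (C * beta ^+ r * (w ^+ r * b))
    [set x | 0 <= x < 1 /\ E (iter r T x)].
Proof.
move=> cov; have w0 : 0 <= w ^+ r * b.
  have [c [_ _ cb]] := cov; rewrite mulr_ge0 ?exprn_ge0 ?powR_ge0 //.
  by apply: le_trans cb; apply: sumr_ge0 => *; exact: powR_ge0.
pose L := left_endpoints beta r 1.
apply: (@finite_cover_le _ s (delta / beta ^+ r) _ (\sum_(0 <= i < size L) w ^+ r * b)) => //.
  rewrite sumr_const_nat subn0 -mulr_natl; apply: ler_wpM2r => //.
  exact: size_left_endpoints_le.
apply: (@finite_cover_bigcup _ s _ _ _ (fun i => [set nth 0 L i + x / beta ^+ r | x in E])).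
  by move=> i _; exact: finite_cover_scale.
move=> x [x01 Ex]; have t1 : 0 < (1 : R) <= 1 by rewrite ltr01 lexx.
have [a aL xE] := left_endpoints_cover beta1 r t1 x01.
exists (index a L); first by rewrite index_mem.
by exists (iter r T x) => //; rewrite nth_index.
Qed.

(** A block of zeros is a stretch on which iterating the map is multiplying by a
    power of beta. So the first [m] digits of [x] are runs of arbitrary digits, of
    total length [f], each of them followed by a block of at least [L] zeros. *)
Inductive zero_pattern (L : nat) : nat -> nat -> R -> Prop :=
| ZeroPatternNil x : zero_pattern L 0 0 x
| ZeroPatternCons r l m f x : (L <= l)%N ->
    iter l T (iter r T x) = beta ^+ l * iter r T x ->
    zero_pattern L m f (iter (l + r) T x) ->
    zero_pattern L (r + l + m) (r + f) x.

Lemma zero_pattern_rcons L m f x r l : zero_pattern L m f x -> (L <= l)%N ->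
  iter l T (iter (m + r) T x) = beta ^+ l * iter (m + r) T x ->
  zero_pattern L (m + (r + l)) (f + r) x.
Proof.
move=> P Ll; elim: P => {m f x} [x|r' l' m f x Ll' x' _ IH].
  move=> h; rewrite !add0n -[(r + l)%N]addn0 -[X in zero_pattern _ _ X]addn0.
  by apply: ZeroPatternCons => //; exact: ZeroPatternNil.
move=> h; rewrite -addnA -[(r' + f + r)%N]addnA; apply: ZeroPatternCons => //.
apply: IH; rewrite -(iterD (m + r)%N (l' + r')%N).
by rewrite (_ : m + r + (l' + r') = r' + l' + m + r)%N //; clear; lia.
Qed.

(** Entropy of the pattern itself is negligible when its blocks are long: the
    generating function of one run followed by one block of length at least [L] is
    C lambda^-L / (1 - 1/lambda)^2 at 1/lambda. *)
Lemma zero_pattern_cover (lambda : R) : 1 < lambda -> 0 <= s ->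
  exists2 L, (0 < L)%N & forall m f,
    finite_cover s (beta ^+ m)^-1 (lambda ^+ m * beta ^+ f * w ^+ m)
      [set x | 0 <= x < 1 /\ zero_pattern L m f x].
Proof.
move=> lam1 s0; have lam0 : 0 < lambda by exact: lt_trans lam1.
pose z := lambda^-1; pose G := (1 - z)^-1.
have z0 : 0 < z by rewrite invr_gt0.
have z1 : z < 1 by rewrite invf_lt1.
have G0 : 0 <= G by rewrite invr_ge0 subr_ge0 ltW.
have C0 : 0 <= C by rewrite divr_ge0 ?(base_ge0 beta1) // subr_ge0 ltW.
have [L L0 LP] : exists2 L, (0 < L)%N & C * z ^+ L * (G * G) <= 1.
  have : (fun n => C * z ^+ n * (G * G)) n @[n --> \oo] --> (C * 0 * (G * G) : R).
    apply: cvgM; last exact: cvg_cst.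
    by apply: cvgM; [exact: cvg_cst | apply: cvg_expr; rewrite ger0_norm // ltW].
  rewrite mulr0 mul0r => /cvgrPdist_le /(_ _ ltr01)[M _ MP].
  exists M.+1 => //; have := MP M.+1 (leqnSn _).
  by rewrite sub0r normrN; apply: le_trans; exact: ler_norm.
exists L => //; elim/ltn_ind => m IH f.
have w0 n : 0 <= w ^+ n by rewrite exprn_ge0 ?powR_ge0.
have K0 : 0 <= lambda ^+ m * beta ^+ f * w ^+ m.
  by apply: mulr_ge0 => //; apply: mulr_ge0; rewrite exprn_ge0 ?(base_ge0 beta1) ?(ltW lam0).
case: m IH K0 => [|m] IH K0.
  apply: (@finite_cover_le _ s 1 _ 1); first by rewrite expr0 invr1.
    by rewrite expr0 mul1r mulr1 exprn_ege1 // ltW.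
  have := @finite_cover_itv _ s 0 1 ler01; rewrite powR1 add0r => -[c [c1 cE cb]].
  by exists c; split=> // x [/andP[x0 x1] _]; apply: cE; rewrite /= in_itv /= x0 ltW.
set K := (X in finite_cover _ _ X _) in K0 *.
pose good r l := (r + (L + l) <= m.+1)%N && (r <= f)%N.
pose F r l := [set x | [/\ good r l, 0 <= x < 1,
   iter (L + l) T (iter r T x) = beta ^+ (L + l) * iter r T x &
   zero_pattern L (m.+1 - (r + (L + l))) (f - r) (iter (L + l) T (iter r T x))]].
apply: (@finite_cover_le _ s (beta ^+ m.+1)^-1 _
  (\sum_(0 <= r < m.+2) \sum_(0 <= l < m.+2) C * z ^+ L * (z ^+ r * z ^+ l) * K)) => //.
  under eq_bigr do rewrite -mulr_suml -mulr_sumr -mulr_sumr.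
  rewrite -mulr_suml -mulr_sumr -mulr_suml ler_piMl //.
  apply: le_trans LP; apply: ler_wpM2l; first by rewrite mulr_ge0 ?exprn_ge0 ?(ltW z0).
  apply: ler_pM; rewrite ?sumr_ge0 ?geometric_sum_le ?(ltW z0) ?z1 //; move=> *;
    by rewrite exprn_ge0 ?(ltW z0).
apply: (@finite_cover_bigcup _ s _ _ _ (fun r x => exists2 l, (l < m.+2)%N & F r l x)).
  move=> r _; apply: (@finite_cover_bigcup _ s _ _ _ (F r)) => // l _.
  have [/andP[rlm rf]|ngood] := boolP (good r l); last first.
    apply: (@finite_cover_le _ s (beta ^+ m.+1)^-1 _ 0) => //.
      by apply: mulr_ge0 => //; apply: mulr_ge0; apply: mulr_ge0; rewrite ?exprn_ge0 ?(ltW z0).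
    rewrite (_ : F r l = set0); first exact: finite_cover0.
    by apply/seteqP; split=> // x [g]; rewrite g in ngood.
  have m'm : (m.+1 - (r + (L + l)) < m.+1)%N by clear -L0; lia.
  have := IH _ m'm (f - r)%N.
  move=> /(finite_cover_block (L + l)) /(finite_cover_preimage r).
  set d1 := (X in finite_cover _ X); set b1 := (X in finite_cover _ _ X).
  have d1E : d1 = (beta ^+ m.+1)^-1.
    rewrite /d1 -!invfM -!exprD; congr (_ ^+ _)^-1; clear -rlm; lia.
  have b1E : b1 = C * z ^+ L * (z ^+ r * z ^+ l) * K.
    rewrite /b1 /K.
    set m' := (m.+1 - _)%N; have -> : m.+1 = (m' + r + (L + l))%N by rewrite /m'; clear -rlm; lia.
    have [f' ->] : exists f', f = (f' + r)%N by exists (f - r)%N; rewrite subnK.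
    rewrite addnK /z !exprVn !exprD; field.
    have b10 : beta - 1 != 0 by rewrite subr_eq0 gt_eqF.
    by rewrite b10 !expf_neq0 ?gt_eqF.
  rewrite d1E b1E => -[c [cd cE cb]]; exists c; split=> // x [_ x01 xb xP].
  apply: cE; split=> //; split=> //; split=> //.
  by rewrite -iterD; exact: iter_beta_transformation_itv.
move=> x [x01]; move: {2 3}m.+1 {1 3}f (erefl m.+1) (erefl f) => m' f' mE fE P.
case: P x01 mE fE => {m' f' x} // r l m' f' x Ll xb xP x01 mE fE.
have lE : l = (L + (l - L))%N by rewrite subnKC.
exists r; first by clear -L0 Ll mE; lia.
exists (l - L)%N; first by clear -L0 Ll mE; lia.
split=> //; rewrite -?lE //.
- by apply/andP; split; [clear -Ll mE|clear -fE]; lia.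
- rewrite -iterD; have -> : (m.+1 - (r + l) = m')%N by clear -L0 Ll mE; lia.
  by have -> : (f - r = f')%N by clear -fE; lia.
Qed.

End Pullback.

(** * Blocks of zeros along uniformly approximating orbits *)

Section Growth.
Local Open Scope ring_scope.
Context {R : realType}.

Lemma nat_gt (x : R) : exists n : nat, x < n%:R.
Proof. by exists (Num.truncn x).+1; exact: truncnS_gt. Qed.

(** With r_k = S_(k+1) / S_k the recurrence reads
    r_(k+1) <= (b - eta / r_k) / a for a = (1 - eta) v and b = eta (1 - v). The
    condition on eta says that a r^2 - b r + eta has no real root, so that each
    step lowers r_k by a fixed amount, although r_k >= 1. *)
Lemma block_sums_absurd (S : nat -> R) (eta v : R) :
  0 < eta < 1 -> 0 < v < 1 -> eta * (1 + v) ^+ 2 < 4 * v ->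
  0 < S 0%N -> (forall k, S k <= S k.+1) ->
  (forall k, S k.+2 <= eta * (S k.+2 - S k.+1 + (S k.+1 - S k) / v)) -> False.
Proof.
move=> /andP[eta0 eta1] /andP[v0 v1] disc S00 Sle Srec.
have S0 k : 0 < S k by elim: k => // k IH; exact: lt_le_trans (Sle k).
pose a := (1 - eta) * v; pose b := eta * (1 - v).
have a0 : 0 < a by rewrite mulr_gt0 // subr_gt0.
have b0 : 0 < b by rewrite mulr_gt0 // subr_gt0.
pose q := Num.sqrt (a * eta).
have q0 : 0 <= q by exact: sqrtr_ge0.
have qE : q ^+ 2 = a * eta by rewrite sqr_sqrtr // mulr_ge0 // ltW.
have bq : b < 2 * q.
  rewrite ltNge; apply/negP => le.
  have : (2 * q) ^+ 2 <= b ^+ 2 by rewrite ler_pXn2r // nnegrE ?(ltW b0) // mulr_ge0.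
  rewrite exprMn qE /a /b; nra.
pose c := (2 * q - b) / a.
have c0 : 0 < c by rewrite divr_gt0 // subr_gt0.
pose r k := S k.+1 / S k.
have r1 k : 1 <= r k by rewrite ler_pdivlMr // mul1r.
have rS k : r k.+1 <= r k - c.
  have rk0 : 0 < r k by exact: lt_le_trans (r1 k).
  have E1 : S k.+1 = r k * S k by rewrite divfK // gt_eqF.
  have E2 : S k.+2 = r k.+1 * S k.+1 by rewrite divfK // gt_eqF.
  have := Srec k; rewrite E2 E1.
  set x := r k.+1; set y := r k in rk0 *; set Sk := S k; have Sk0 : 0 < Sk by exact: S0.
  rewrite (_ : eta * _ = eta * (x * y - y + (y - 1) / v) * Sk); last by ring.
  rewrite mulrA ler_pM2r // => h.
  have h2 : a * (x * y) <= b * y - eta.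
    have : x * y * v <= eta * (x * y - y + (y - 1) / v) * v by rewrite ler_pM2r.
    rewrite (_ : eta * _ * v = eta * ((x * y - y) * v + (y - 1))); last by field; rewrite gt_eqF.
    rewrite /a /b; nra.
  have h3 : (b + a * c) * y <= a * y ^+ 2 + eta.
    have -> : b + a * c = 2 * q by rewrite /c mulrC divfK ?gt_eqF // subrKC.
    have sq : 0 <= (a * y - q) ^+ 2 by exact: sqr_ge0.
    rewrite -(ler_pM2l a0); move: sq; rewrite sqrrB qE; nra.
  have h4 : a * (x * y) <= a * ((y - c) * y) by nra.
  by move: h4; rewrite ler_pM2l // ler_pM2r.
have rk k : r k <= r 0%N - k%:R * c.
  elim: k => [|k IH]; first by rewrite mul0r subr0.
  by apply: le_trans (rS k) _; rewrite -natr1; nra.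
have [n nP] := nat_gt (r 0%N / c).
have := le_trans (r1 n) (rk n); rewrite ltr_pdivrMr // in nP; lra.
Qed.

(** The application is to [tau n] = the time that multiplication by beta needs to
    lift the n-th iterate to 1 or more, which drops by 1 per step until it runs
    out. Hence the next record of [tau] after a record at [n] occurs only at or
    after [n + tau n]; and just before it occurs the largest value so far is still
    [tau n], which must therefore meet the bound required at that moment. *)
Lemma record_sequence (tau : nat -> nat) (v : R) (N0 K : nat) :
  0 < v -> (forall n, 0 < tau n)%N ->
  (forall n, (1 < tau n)%N -> tau n.+1 = (tau n).-1) ->
  (forall N, (N0 <= N)%N -> exists2 n, (n <= N)%N & v * N%:R < (tau n)%:R) ->
  exists nn : nat -> nat,
    [/\ (K <= nn 0)%N, (K <= tau (nn 0))%N,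
        forall k, (nn k + tau (nn k) <= nn k.+1)%N,
        forall k, (tau (nn k) < tau (nn k.+1))%N &
        forall k, v * ((nn k.+1)%:R - 1) < (tau (nn k))%:R].
Proof.
move=> v0 tau0 tauS hit.
pose record n := forall j, (j <= n)%N -> (tau j <= tau n)%N.
have next n : exists n', record n ->
    [/\ (n + tau n <= n')%N, (tau n < tau n')%N, record n' &
     (N0 < n')%N -> v * (n'%:R - 1) < (tau n)%:R].
  have [rn|] := pselect (record n); last by exists 0%N.
  have exn : exists n', (tau n < tau n')%N.
    have [m mP] := nat_gt ((tau n)%:R / v).
    have [n' _ n'P] := hit (maxn N0 m) (leq_maxl _ _).
    exists n'; rewrite -(ltr_nat R); apply: le_lt_trans n'P.
    by rewrite mulrC -ler_pdivrMr // (le_trans (ltW mP)) // ler_nat leq_maxr.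
  exists (ex_minn exn) => _; case: ex_minnP => n' lt min.
  have below j : (j < n')%N -> (tau j <= tau n)%N.
    by move=> jn'; rewrite leqNgt; apply/negP => /min; rewrite leqNgt jn'.
  have dec j : (j < tau n)%N -> tau (n + j)%N = (tau n - j)%N.
    elim: j => [|j IH] jn; first by rewrite addn0 subn0.
    by rewrite addnS tauS IH; lia.
  split=> //.
  - rewrite leqNgt; apply/negP => n'lt.
    have [n'n|nn'] := leqP n' n; first by have := rn _ n'n; rewrite leqNgt lt.
    have := dec (n' - n)%N; rewrite subnKC ?(ltnW nn') //; lia.
  - move=> j; rewrite leq_eqVlt => /orP[/eqP-> //|/below le].
    exact: leq_trans le (ltnW lt).
  - move=> N0n'; have [|k kle kP] := hit n'.-1; first by lia.
    have n'0 : (0 < n')%N by lia.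
    apply: le_lt_trans (_ : v * n'.-1%:R < _).
      by rewrite -subn1 natrB.
    apply: lt_le_trans kP _; rewrite ler_nat; apply: below; lia.
have [nxt nxtP] := choice next.
pose n_ k := iter k nxt 0%N.
have rec k : record (n_ k).
  elim: k => [|k IH]; first by move=> j; rewrite leqn0 => /eqP->.
  by have [] := nxtP _ IH.
have step k := nxtP _ (rec k).
have n_S k : nxt (n_ k) = n_ k.+1 by [].
have grow k : (k <= n_ k)%N && (k <= tau (n_ k))%N.
  elim: k => // k IH; have := step k; rewrite n_S => -[]; have := tau0 (n_ k); lia.
exists (fun k => n_ (k + (N0 + K))%N); split; try move=> k.
- by have := grow (0 + (N0 + K))%N; lia.
- by have := grow (0 + (N0 + K))%N; lia.
- by have [] := step (k + (N0 + K))%N.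
- by have [] := step (k + (N0 + K))%N.
- have [_ _ _] := step (k + (N0 + K))%N; apply; rewrite n_S.
  by have := grow (k + (N0 + K)).+1; lia.
Qed.

End Growth.

Section UniformOrbits.
Local Open Scope classical_set_scope.
Local Open Scope ring_scope.
Context {R : realType} (beta : R) (beta1 : 1 < beta).
Implicit Types (x v : R).
Local Notation T := (beta_transformation beta).

Definition uniformly_hits v x := exists N0, forall N, (N0 <= N)%N ->
  exists2 n, (n <= N)%N & iter n T x < beta `^ (- (v * N%:R)).

Lemma waiting_time x : 0 <= x < 1 -> (forall n, iter n T x != 0) ->
  exists tau : nat -> nat,
    [/\ forall n, 1 <= beta ^+ tau n * iter n T x,
        forall n j, (j < tau n)%N -> beta ^+ j * iter n T x < 1,
        forall n, (0 < tau n)%N &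
        forall n, (1 < tau n)%N -> tau n.+1 = (tau n).-1].
Proof.
move=> x01 nz; have it n := iter_beta_transformation_itv beta n x01.
have pos n : 0 < iter n T x by rewrite lt_def nz; have /andP[] := it n.
have /choice[tau tauP] n : exists t, 1 <= beta ^+ t * iter n T x /\
    forall j, (j < t)%N -> beta ^+ j * iter n T x < 1.
  have ex : exists t, 1 <= beta ^+ t * iter n T x.
    have : (fun t => (beta^-1) ^+ t) t @[t --> \oo] --> (0 : R).
      apply: cvg_expr; rewrite ger0_norm ?invr_ge0 ?(base_ge0 beta1) // invf_lt1 //.
      exact: base_gt0.
    move=> /cvgrPdist_le /(_ _ (pos n))[M _ MP]; exists M.
    have := MP M (leqnn _).
    rewrite sub0r normrN ger0_norm ?exprn_ge0 ?invr_ge0 ?(base_ge0 beta1) //.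
    by rewrite exprVn -ler_pdivrMl ?(base_exp_gt0 beta1) // mulr1.
  exists (ex_minn ex); case: ex_minnP => t t1 min; split=> // j jt.
  by rewrite ltNge; apply/negP => /min; rewrite leqNgt jt.
have t1 n : 1 <= beta ^+ tau n * iter n T x by have [] := tauP n.
have t2 n j : (j < tau n)%N -> beta ^+ j * iter n T x < 1 by have [_] := tauP n; exact.
have t3 n : (0 < tau n)%N.
  rewrite lt0n; apply/eqP => E; have := t1 n; rewrite E expr0 mul1r leNgt.
  by have /andP[_ ->] := it n.
exists tau; split=> // n lt1.
have TE : iter n.+1 T x = beta * iter n T x.
  have := iter_beta_transformation_small beta1 (n := 1) (ltW (pos n)).
  by rewrite expr1 /=; apply; have := t2 n 1%N lt1; rewrite expr1.
apply/eqP; rewrite eqn_leq; apply/andP; split; rewrite leqNgt; apply/negP => lt.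
  have := t2 _ _ lt; rewrite TE mulrA -exprSr prednK // => h.
  by have := t1 n; rewrite leNgt h.
have lt' : ((tau n.+1).+1 < tau n)%N by lia.
have := t2 _ _ lt'; rewrite exprSr -mulrA -TE => h.
by have := t1 n.+1; rewrite leNgt h.
Qed.

Lemma waiting_time_gt v (N t : nat) y : 0 < y ->
  1 <= beta ^+ t * y -> y < beta `^ (- (v * N%:R)) -> v * N%:R < t%:R.
Proof.
move=> y0 t1 yN; rewrite ltNge; apply/negP => le.
have B1 : beta `^ t%:R * beta `^ (- (v * N%:R)) <= 1.
  rewrite -powRD; last by rewrite (gt_eqF (base_gt0 beta1)) implybT.
  have := @ler_powR _ beta (ltW beta1) (t%:R - v * N%:R) 0.
  by rewrite powRr0; apply; rewrite subr_le0.
have : beta ^+ t * y < 1.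
  apply: lt_le_trans B1.
  by rewrite powR_mulrn ?(base_ge0 beta1) // ltr_pM2l // (base_exp_gt0 beta1).
by move=> /(le_lt_trans t1); rewrite ltxx.
Qed.

(** After a record of height tau the next one comes at a time n' >= tau, whereas
    v (n' - 1) < tau: for v > 1 this bounds all records, which however tend to
    infinity along an orbit that avoids 0. *)
Lemma uniformly_hits_fast v x : 1 < v -> 0 <= x < 1 -> uniformly_hits v x ->
  exists n, iter n T x = 0.
Proof.
move=> v1 x01 [N0 hit]; apply: contrapT => nz'.
have nz n : iter n T x != 0 by apply/eqP => E; apply: nz'; exists n.
have [tau [t1 t2 t3 t4]] := waiting_time x01 nz.
have pos n : 0 < iter n T x.
  by rewrite lt_def nz; have /andP[] := iter_beta_transformation_itv beta n x01.
have hit' N : (N0 <= N)%N -> exists2 n, (n <= N)%N & v * N%:R < (tau n)%:R.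
  move=> /hit[n nN nv]; exists n => //; exact: waiting_time_gt (pos n) (t1 n) nv.
have [K KP] := nat_gt (v / (v - 1)).
have v0 : 0 < v by lra.
have [nn [_ tK n1 _ n3]] := record_sequence K v0 t3 t4 hit'.
have := n3 0%N; apply/negP; rewrite -leNgt.
have h : (tau (nn 0%N))%:R <= (nn 1%N)%:R :> R.
  rewrite ler_nat; apply: leq_trans (n1 0%N); exact: leq_addl.
have h2 : v <= (v - 1) * (tau (nn 0%N))%:R.
  have : K%:R <= (tau (nn 0%N))%:R :> R by rewrite ler_nat.
  rewrite ltr_pdivrMr ?subr_gt0 // in KP; nra.
by nra.
Qed.

(** The blocks of zeros are those that follow the records of the waiting time.
    Were zeros always to fill less than the fraction eta of the digits read, the
    total lengths of the blocks would satisfy the recurrence excluded by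
    [block_sums_absurd]. An orbit that reaches 0 has a single endless block. *)
Lemma uniformly_hits_pattern v v' (eta : R) L M x :
  0 < v' < v -> v < 1 -> 0 < eta < 1 -> eta * (1 + v') ^+ 2 < 4 * v' -> (0 < L)%N ->
  0 <= x < 1 -> uniformly_hits v x ->
  exists m f, [/\ (M <= m)%N, f%:R <= (1 - eta) * m%:R & zero_pattern beta L m f x].
Proof.
move=> /andP[v'0 v'v] v1 /andP[eta0 eta1] disc L0 x01 [N0 hit].
have v0 : 0 < v by exact: lt_trans v'v.
have it n := iter_beta_transformation_itv beta n x01.
have [[n n0]|nz'] := pselect (exists n, iter n T x = 0).
  have zero l : iter l T (iter n T x) = 0.
    rewrite n0; elim: l => // l IH; rewrite iterS IH.
    by rewrite beta_transformation_small ?mulr0 // lexx ltr01.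
  have [l lP] := nat_gt (eta / (1 - eta) * n%:R + n%:R / (1 - eta)).
  pose l' := (l + L + M)%N.
  exists (n + l' + 0)%N, (n + 0)%N; split; first by rewrite /l'; clear; lia.
    rewrite !addn0 natrD.
    have : l%:R <= l'%:R :> R by rewrite ler_nat /l'; clear; lia.
    have e1 : 0 < 1 - eta by lra.
    have : n%:R = (n%:R / (1 - eta)) * (1 - eta) by rewrite divfK // gt_eqF.
    have : 0 <= eta / (1 - eta) * n%:R by rewrite mulr_ge0 // divr_ge0 // ltW.
    have : 0 <= n%:R :> R by [].
    by nra.
  apply: ZeroPatternCons;
    [by rewrite /l'; clear; lia | by rewrite zero n0 mulr0 | exact: ZeroPatternNil].
have nz n : iter n T x != 0 by apply/eqP => E; apply: nz'; exists n.
have [tau [t1 t2 t3 t4]] := waiting_time x01 nz.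
have pos n : 0 < iter n T x by rewrite lt_def nz; have /andP[] := it n.
have hit' N : (N0 <= N)%N -> exists2 n, (n <= N)%N & v * N%:R < (tau n)%:R.
  move=> /hit[n nN nv]; exists n => //; exact: waiting_time_gt (pos n) (t1 n) nv.
(* Beyond K0 the additive errors due to rounding are absorbed by the gap between
   v' and v. *)
have [K0 K0P] := nat_gt ((v^-1 + 1) / (v'^-1 - v^-1)).
have [nn [nM tK n1 n2 n3]] := record_sequence (K0 + L + M + 1) v0 t3 t4 hit'.
pose l k := (tau (nn k)).-1.
have tE k : tau (nn k) = (l k).+1 by rewrite prednK.
have lK k : (K0 + L + M <= l k)%N.
  elim: k => [|k IH]; first by rewrite /l; clear -tK; lia.
  by have := n2 k; rewrite !tE; clear -IH; lia.
pose m k := (nn k + l k)%N.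
pose S k := (\sum_(0 <= j < k.+1) l j)%N.
have SS k : S k.+1 = (S k + l k.+1)%N by rewrite /S big_nat_recr.
have S0 : S 0%N = l 0%N by rewrite /S big_nat1.
have mS k : (m k < nn k.+1)%N by have := n1 k; rewrite tE /m; clear; lia.
have Sm k : (S k <= m k)%N.
  elim: k => [|k IH]; first by rewrite S0 /m leq_addl.
  by rewrite SS /m leq_add2r (leq_trans IH) // ltnW.
have block n j : (j < tau n)%N -> iter j T (iter n T x) = beta ^+ j * iter n T x.
  by move=> jt; rewrite iter_beta_transformation_small // ?t2 // ltW.
have pat k : zero_pattern beta L (m k) (m k - S k) x.
  elim: k => [|k IH].
    rewrite S0 /m addnK -[(nn 0 + _)%N]addn0 -[X in zero_pattern _ _ _ X]addn0.
    apply: ZeroPatternCons; [by have := lK 0%N; clear; lia | | exact: ZeroPatternNil].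
    by apply: block; rewrite tE.
  have := zero_pattern_rcons (r := (nn k.+1 - m k)%N) (l := l k.+1) IH.
  rewrite subnKC ?(ltnW (mS k)) // addnA subnKC ?(ltnW (mS k)) //.
  have -> : (m k - S k + (nn k.+1 - m k) = m k.+1 - S k.+1)%N.
    by rewrite SS /m; have := Sm k; have := mS k; rewrite /m; clear; lia.
  apply; [by have := lK k.+1; clear; lia | by apply: block; rewrite tE].
have mM k : (M <= m k)%N by have := lK k; rewrite /m; clear; lia.
apply: contrapT => none.
have Sup k : (S k)%:R < eta * (m k)%:R :> R.
  rewrite ltNge; apply/negP => le; apply: none; exists (m k), (m k - S k)%N; split=> //.
  by rewrite natrB //; lra.
apply: (@block_sums_absurd R (fun k => (S k)%:R) eta v') => //.
- by rewrite eta0.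
- by rewrite v'0 (lt_trans v'v).
- by rewrite ltr0n S0; have := lK 0%N; clear -L0; lia.
- by move=> k; rewrite ler_nat SS leq_addr.
move=> k; apply/ltW/(lt_le_trans (Sup k.+2)); rewrite ler_pM2l //.
rewrite [in leRHS]SS [in X in _ + X / _]SS !natrD.
rewrite ![_%:R + _%:R - _%:R]addrAC !subrr !add0r addrC lerD2l.
have Kl : (v^-1 + 1) <= (l k.+1)%:R * (v'^-1 - v^-1).
  have dv : 0 < v'^-1 - v^-1 by rewrite subr_gt0 ltf_pV2.
  rewrite ltr_pdivrMr // in K0P; apply: le_trans (ltW K0P) _.
  by rewrite ler_pM2r // ler_nat; have := lK k.+1; clear; lia.
have := n3 k.+1; rewrite tE -natr1 => h.
have h2 : (nn k.+2)%:R < ((l k.+1)%:R + 1) / v + 1.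
  by rewrite -ltrBlDr ltr_pdivlMr // mulrC.
apply: le_trans (ltW h2) _; rewrite mulrDl mul1r; lra.
Qed.

End UniformOrbits.

(** * Upper bounds *)

Section UpperBounds.
Local Open Scope classical_set_scope.
Local Open Scope ring_scope.
Context {R : realType} (beta : R) (beta1 : 1 < beta).
Implicit Types (A E : set R) (s x z lambda : R).
Local Notation T := (beta_transformation beta).
Local Hint Resolve base_gt0 base_exp_gt0 base_ge0 base_exp_ge0 : core.

Lemma geometric_small z : 0 <= z < 1 ->
  forall e : R, 0 < e -> exists M, forall m, (M <= m)%N -> z ^+ m <= e.
Proof.
move=> /andP[z0 z1] e e0.
have : (fun n => z ^+ n) n @[n --> \oo] --> (0 : R) by apply: cvg_expr; rewrite ger0_norm.
move=> /cvgrPdist_le /(_ _ e0)[M _ MP]; exists M => m Mm.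
by have := MP m Mm; rewrite sub0r normrN ger0_norm ?exprn_ge0.
Qed.

Lemma succn_le_geometric lambda : 1 < lambda ->
  exists2 K, 0 <= K & forall m, m.+1%:R <= K * lambda ^+ m.
Proof.
move=> l1; have l0 : 0 < lambda - 1 by rewrite subr_gt0.
have i0 : 0 < (lambda - 1)^-1 by rewrite invr_gt0.
exists (1 + (lambda - 1)^-1) => [|m]; first by rewrite addr_ge0 // ltW.
have bern : 1 + m%:R * (lambda - 1) <= lambda ^+ m.
  elim: m => [|m IH]; first by rewrite mul0r addr0.
  rewrite exprS -natr1; have l1' : 0 <= lambda by lra.
  have := ler_wpM2l l1' IH; have : 0 <= m%:R * (lambda - 1) ^+ 2 by rewrite mulr_ge0 // sqr_ge0.
  rewrite expr2; nra.
apply: le_trans (ler_wpM2l _ bern); last by rewrite addr_ge0 // ltW.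
have iE : (lambda - 1)^-1 * (lambda - 1) = 1 by rewrite mulVf // gt_eqF.
rewrite -natr1; have : 0 <= m%:R * (lambda - 1) by rewrite mulr_ge0 // ltW.
set d := lambda - 1 in i0 iE *; set i := d^-1 in i0 iE *.
have -> : (1 + i) * (1 + m%:R * d) = 1 + m%:R * d + i + m%:R * (i * d) by ring.
by rewrite iE mulr1; lra.
Qed.

Lemma ltr_powR_base (a b : R) : (beta `^ a < beta `^ b) = (a < b).
Proof. by rewrite /powR (gt_eqF (base_gt0 beta1)) ltr_expR ltr_pM2r // ln_gt0. Qed.

Lemma powR_base_lt1 (k : R) : k < 0 -> 0 <= beta `^ k < 1.
Proof. by rewrite -ltr_powR_base powRr0 powR_ge0. Qed.

Lemma powR_base_gt1 (k : R) : 0 < k -> 1 < beta `^ k.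
Proof. by rewrite -ltr_powR_base powRr0. Qed.

Lemma powR_baseD (a b : R) : beta `^ (a + b) = beta `^ a * beta `^ b.
Proof. by rewrite powRD // (gt_eqF (base_gt0 beta1)) implybT. Qed.

Lemma powR_base_nat (a : R) n : beta `^ (a * n%:R) = (beta `^ a) ^+ n.
Proof. by rewrite powRrM powR_mulrn // powR_ge0. Qed.

Lemma finite_cover_set1U s delta b E a : s != 0 -> 0 <= delta ->
  finite_cover s delta b E -> finite_cover s delta b (a |` E).
Proof.
move=> s0 d0 cov; have := finite_coverU (b := 0) (E := [set a]) _ cov.
rewrite add0r; apply; exists [:: (a, 0)]; split.
- by move=> p /[!inE] /eqP ->; rewrite lexx d0.
- by move=> x ->; exists (a, 0); rewrite ?mem_head //= addr0 lexx.
- by rewrite big_seq1 powR0.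
Qed.

Lemma unit_itv_cover s : finite_cover s 1 1 [set x : R | 0 <= x < 1].
Proof.
have := @finite_cover_itv _ s 0 1 ler01; rewrite powR1 add0r => -[c [c1 cE cb]].
by exists c; split=> // x /= /andP[x0 x1]; apply: cE; rewrite /= in_itv /= x0 ltW.
Qed.

Lemma hausdorff_measure_unit_eq0 s A : 1 < s -> A `<=` `[0, 1] ->
  hausdorff_measure s A = 0%E.
Proof.
move=> s1 A01; have s0 : 0 < s by exact: lt_trans s1.
have zP : 0 <= beta `^ (1 - s) < 1 by apply: powR_base_lt1; rewrite subr_lt0.
have C0 : 0 <= beta / (beta - 1) by rewrite divr_ge0 ?(base_ge0 beta1) // subr_ge0 ltW.
have ib : 0 <= beta^-1 < 1.
  by rewrite invr_ge0 (base_ge0 beta1) invf_lt1 // (base_gt0 beta1).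
apply: (@hausdorff_measure_limsup_eq0 _ s (beta `^ (1 - s)) (beta / (beta - 1))
  (fun m => beta^-1 ^+ m) (fun=> 1 |` [set x | 0 <= x < 1])) => //.
- exact: geometric_small.
- move=> m; apply: finite_cover_set1U; rewrite ?gt_eqF ?exprn_ge0 //.
    by have /andP[] := ib.
  have := finite_cover_preimage beta1 m (unit_itv_cover s).
  rewrite div1r mulr1 -exprVn -mulrA -exprMn.
  have -> : beta * beta `^ (- s) = beta `^ (1 - s).
    by rewrite powR_baseD powRr1 ?(base_ge0 beta1).
  move=> -[c [cd cE cb]]; exists c; split=> // x x01; apply: cE; split=> //.
  exact: iter_beta_transformation_itv.
- move=> x /A01 /=; rewrite in_itv /= => /andP[x0 x1] M; exists M => //.
  by move: x1; rewrite le_eqVlt => /orP[/eqP->|x1]; [left | right; rewrite /= x0].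
Qed.

Lemma uniform_set_le1 psi x : uniform_set beta psi x -> x = 1 \/ 0 <= x < 1.
Proof.
move=> [/andP[x0 x1] _]; move: x1; rewrite le_eqVlt => /orP[/eqP|x1]; first by left.
by right; rewrite x0.
Qed.

(** Only the infinitely many good [N] are used. At each of them the set is covered
    by at most C beta^n intervals of length beta^(-n - u N) for every n <= N; as
    s < 1 the case n = N dominates, with weight beta^(N (1 - s - s u)). *)
Lemma uniform_set_null_limsup psi u s : 0 < u -> 0 < s < 1 -> 1 < s * (1 + u) ->
  (forall M, exists2 N, (M <= N)%N & psi N < beta `^ (- (u * N%:R))) ->
  hausdorff_measure s (uniform_set beta psi) = 0%E.
Proof.
move=> u0 /andP[s0 s1] su small.
(* Half of the margin pays for the N + 1 values of n. *)
pose k := (s * (1 + u) - 1) / 2; have k0 : 0 < k by rewrite divr_gt0 // subr_gt0.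
have [K K0 KP] := succn_le_geometric (powR_base_gt1 k0).
set C := beta / (beta - 1).
have C0 : 0 <= C by rewrite divr_ge0 ?(base_ge0 beta1) // subr_ge0 ltW.
have zP : 0 <= beta `^ (- k) < 1 by apply: powR_base_lt1; rewrite oppr_lt0.
have uP : 0 <= beta `^ (- u) < 1 by apply: powR_base_lt1; rewrite oppr_lt0.
apply: (@hausdorff_measure_limsup_eq0 _ s (beta `^ (- k)) (C * K)
  (fun N => (beta `^ (- u)) ^+ N)
  (fun N => 1 |` [set x | 0 <= x < 1 /\
      exists2 n, (n <= N)%N & iter n T x < beta `^ (- (u * N%:R))])) => //.
- by rewrite mulr_ge0.
- exact: geometric_small.
- move=> N; rewrite -powR_base_nat mulNr; set d := beta `^ (- (u * _)).
  have d0 : 0 <= d by exact: powR_ge0.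
  apply: finite_cover_set1U; rewrite ?gt_eqF //.
  apply: (@finite_cover_le _ s d _
    (\sum_(0 <= n < N.+1) C * (beta `^ (1 - s)) ^+ n * d `^ s)) => //.
    apply: le_trans (_ : \sum_(0 <= n < N.+1) C * (beta `^ (1 - s)) ^+ N * d `^ s <= _).
      rewrite big_nat [leRHS]big_nat; apply: ler_sum => n /andP[_ nN].
      rewrite ler_wpM2r ?powR_ge0 // ler_wpM2l // ler_weXn2l //.
      by apply/ltW/powR_base_gt1; rewrite subr_gt0.
    rewrite sumr_const_nat subn0 -mulr_natl.
    have -> : d `^ s = (beta `^ (- (u * s))) ^+ N.
      by rewrite /d -powRrM -powR_base_nat; congr (_ `^ _); ring.
    rewrite -[C * _ * _]mulrA -exprMn -powR_baseD mulrCA -mulrA ler_wpM2l //.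
    have -> : 1 - s + - (u * s) = - k + - k by rewrite /k; field.
    rewrite powR_baseD exprMn mulrA ler_wpM2r ?exprn_ge0 ?powR_ge0 //.
    apply: le_trans (ler_wpM2r _ (KP N)) _; first by rewrite exprn_ge0 ?powR_ge0.
    by rewrite -mulrA -exprMn -powR_baseD subrr powRr0 expr1n mulr1.
  apply: (@finite_cover_bigcup _ s _ _ _
    (fun n => [set x | 0 <= x < 1 /\ (`[0, d]%classic : set R) (iter n T x)])).
    move=> n _; apply: finite_cover_le (_ : finite_cover s (d / beta ^+ n) _ _).
    + by rewrite ler_pdivrMr ?(base_exp_gt0 beta1) // ler_peMr // exprn_ege1 // ltW.
    + exact: lexx.
    have := finite_cover_preimage beta1 n (finite_cover_itv s 0 d0); rewrite add0r.
    congr (finite_cover _ _ _ _).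
    by rewrite powR_baseD powRr1 ?(base_ge0 beta1) // exprMn !mulrA.
  move=> x [x01 [n nN nd]]; exists n => //; split=> //.
  rewrite /= in_itv /= (ltW nd) andbT.
  by have /andP[] := iter_beta_transformation_itv beta n x01.
- move=> x Ux M; have := uniform_set_le1 Ux.
  move: Ux => [_ [N0 _ hit]] [->|x01].
    by exists M => //; left.
  have [N] := small (maxn M N0); rewrite geq_max => /andP[MN N0N] Nu.
  exists N => //; right; split=> //; have [n nN nP] := hit N N0N.
  by exists n => //; exact: lt_trans nP Nu.
Qed.

(** A point has infinitely many prefixes of some length m with at most
    (1 - eta) m free digits. There are beta^((1 - eta) m) of these up to a factor
    lambda^m for the choice of the pattern and K lambda^m for that of the number of
    free digits. *)
Lemma uniform_set_null_liminf psi v v' (eta s : R) :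
  0 < v' < v -> v < 1 -> 0 < eta < 1 -> eta * (1 + v') ^+ 2 < 4 * v' -> 1 - eta < s ->
  (forall x, uniform_set beta psi x -> 0 <= x < 1 -> uniformly_hits beta v x) ->
  hausdorff_measure s (uniform_set beta psi) = 0%E.
Proof.
move=> v'v v1 /andP[eta0 eta1] disc es hits.
have s0 : 0 < s by lra.
(* Two thirds of the margin s - (1 - eta) pay for the factor lambda^(2 m). *)
pose k := (s - (1 - eta)) / 3; have k0 : 0 < k by rewrite divr_gt0 // subr_gt0.
pose lambda := beta `^ k; have lam1 : 1 < lambda by exact: powR_base_gt1.
have [K K0 KP] := succn_le_geometric lam1.
have [L L0 LP] := zero_pattern_cover beta1 lam1 (ltW s0).
have zP : 0 <= beta `^ (- k) < 1 by apply: powR_base_lt1; rewrite oppr_lt0.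
have ib : 0 <= beta^-1 < 1.
  by rewrite invr_ge0 (base_ge0 beta1) invf_lt1 // (base_gt0 beta1).
apply: (@hausdorff_measure_limsup_eq0 _ s (beta `^ (- k)) K
  (fun m => beta^-1 ^+ m)
  (fun m => 1 |` [set x | 0 <= x < 1 /\
      exists2 f, f%:R <= (1 - eta) * m%:R & zero_pattern beta L m f x])) => //.
- exact: geometric_small.
- move=> m; apply: finite_cover_set1U; rewrite ?gt_eqF ?exprn_ge0 //.
    by have /andP[] := ib.
  have X0 : 0 <= lambda ^+ m * (beta `^ (1 - eta)) ^+ m * (beta `^ (- s)) ^+ m.
    by rewrite !mulr_ge0 // exprn_ge0 // powR_ge0.
  apply: (@finite_cover_le _ s (beta^-1 ^+ m) _ (\sum_(0 <= f < m.+1)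
      lambda ^+ m * (beta `^ (1 - eta)) ^+ m * (beta `^ (- s)) ^+ m)) => //.
    rewrite sumr_const_nat subn0 -mulr_natl -!exprMn.
    apply: le_trans (ler_wpM2r _ (KP m)) _; first by rewrite exprn_ge0 // !mulr_ge0 ?powR_ge0.
    rewrite -[K * _ * _]mulrA -exprMn ler_wpM2l // /lambda -!powR_baseD.
    by rewrite le_eqVlt; apply/orP; left; apply/eqP; congr (_ `^ _ ^+ _); rewrite /k; field.
  apply: (@finite_cover_bigcup _ s _ _ _ (fun f => [set x | f%:R <= (1 - eta) * m%:R /\
      (0 <= x < 1 /\ zero_pattern beta L m f x)])).
    move=> f _; have [fm|mf] := lerP f%:R ((1 - eta) * m%:R); last first.
      apply: (@finite_cover_le _ s (beta^-1 ^+ m) _ 0) => //.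
      rewrite (_ : mkset _ = set0); first exact: finite_cover0.
      by apply/seteqP; split=> // x [].
    apply: finite_cover_le (_ : finite_cover s (beta ^+ m)^-1
        (lambda ^+ m * beta ^+ f * beta `^ (- s) ^+ m) _).
    + by rewrite exprVn.
    + rewrite ler_wpM2r ?exprn_ge0 ?powR_ge0 // ler_wpM2l ?exprn_ge0 ?powR_ge0 //.
      rewrite -powR_base_nat -powR_mulrn ?(base_ge0 beta1) //; apply: ler_powR => //.
      exact: ltW.
    + by have [c [cd cE cb]] := LP m f; exists c; split=> // x [_ /cE].
  move=> x [x01 [f fm xP]]; exists f; last by [].
  have : f%:R <= m%:R :> R by apply: le_trans fm _; rewrite ler_piMl //; lra.
  by rewrite ler_nat.
- move=> x Ux M; have [->|x01] := uniform_set_le1 Ux; first by exists M => //; left.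
  have e01 : 0 < eta < 1 by rewrite eta0.
  have [m [f [Mm fm xP]]] := uniformly_hits_pattern beta1 M v'v v1 e01 disc L0 x01 (hits _ Ux x01).
  by exists m => //; right; split=> //; exists f.
Qed.

Lemma uniform_set_countable psi v : 1 < v ->
  (forall x, uniform_set beta psi x -> 0 <= x < 1 -> uniformly_hits beta v x) ->
  countable (uniform_set beta psi).
Proof.
move=> v1 hits.
apply: (@sub_countable _ _ _ (\bigcup_n [set` (1 : R) :: left_endpoints beta n 1])).
  apply: subset_card_le => x Ux; have [->|x01] := uniform_set_le1 Ux.
    by exists 0%N => //=; rewrite mem_head.
  have [n n0] := uniformly_hits_fast beta1 v1 x01 (hits _ Ux x01).
  exists n => //=; have t1 : 0 < (1 : R) <= 1 by rewrite ltr01 lexx.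
  have [a aL ->] := left_endpoints_cover beta1 n t1 x01.
  by rewrite n0 mul0r addr0 inE aL orbT.
by apply: bigcup_countable => // n _; exact/finite_set_countable/finite_seq.
Qed.

End UpperBounds.

(** * A sparse schedule of zero blocks *)

Section Schedule.
Local Open Scope ring_scope.
Context {R : realType}.
Implicit Types (free : pred nat) (i k : nat).

Definition free_count free i := count free (iota 0 i).

Lemma free_countS free i : free_count free i.+1 = (free_count free i + free i)%N.
Proof. by rewrite /free_count -addn1 iotaD count_cat /= addn0. Qed.

Lemma free_countD_ge free i l : (free_count free i <= free_count free (i + l))%N.
Proof. by elim: l => [|l IH]; rewrite ?addn0 // addnS free_countS; lia. Qed.

Lemma free_countD free i l : (forall j, (i <= j < i + l)%N -> free j) ->
  free_count free (i + l) = (free_count free i + l)%N.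
Proof.
elim: l => [|l IH] fr; first by rewrite !addn0.
rewrite addnS free_countS IH => [|j /andP[ij jl]]; last by apply: fr; rewrite ij /=; clear -jl; lia.
by rewrite fr ?leq_addr //=; [clear; lia | clear; lia].
Qed.

Lemma bracket_index (n_ : nat -> nat) i : (forall k, (k <= n_ k)%N) -> (n_ 0 <= i)%N ->
  exists k, (n_ k <= i < n_ k.+1)%N.
Proof.
move=> grow n0i.
have ex : exists k, (i < n_ k.+1)%N by exists i; exact: leq_trans (grow i.+1).
exists (ex_minn ex); case: ex_minnP => k lt min; rewrite lt andbT.
case: k lt min => // k lt min; rewrite leqNgt; apply/negP => /min.
by rewrite ltnn.
Qed.

(** The extremal schedule: zeros on [rho^k, sigma rho^k[ and free levels on
    [sigma rho^k, rho^(k+1)[, with rho = 2 / (1 - v) the double root of the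
    quadratic behind [block_sums_absurd]. The zero blocks have length
    v rho^(k+1), and since rho - sigma = 1 and rho - 1 = sigma the proportion of
    free levels is smallest at the ends of the zero blocks, where it tends to
    1 / sigma^2 = ((1 - v) / (1 + v))^2. *)
Lemma zero_schedule (u v s1 : R) : 0 < u < v -> v < 1 ->
  0 < s1 < ((1 - v) / (1 + v)) ^+ 2 ->
  exists free : pred nat,
    (exists C : R, forall i, s1 * i%:R <= (free_count free i)%:R + C) /\
    exists I0, forall i, (I0 <= i)%N -> exists n m,
      [/\ (n <= i)%N, (forall j, (n <= j < m)%N -> ~~ free j) &
          u * i.+1%:R <= (m - n)%:R].
Proof.
move=> /andP[u0 uv] v1 /andP[s10 s1lt].
have v0 : 0 < v by exact: lt_trans uv.
have v1' : 0 < 1 - v by rewrite subr_gt0.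
pose rho := 2 / (1 - v); pose sigma := (1 + v) / (1 - v).
have sigma0 : 0 < sigma by rewrite divr_gt0 // addr_gt0.
have rhoE : rho = sigma + 1 by rewrite /rho /sigma; field; rewrite gt_eqF.
have sigma1 : 1 <= sigma by rewrite ler_pdivlMr //; lra.
have sigma_v : sigma - 1 = v * rho by rewrite /rho /sigma; field; rewrite gt_eqF.
have thetaE : ((1 - v) / (1 + v)) ^+ 2 = sigma ^- 2 by rewrite /sigma -exprVn invf_div.
have rho2 : 2 <= rho by rewrite rhoE; lra.
have rho0 : 0 < rho by lra.
have rhok0 k : 0 < rho ^+ k by exact: exprn_gt0.
have rhok k : k.+1%:R <= rho ^+ k.
  elim: k => [|k IH]; first by rewrite expr0.
  rewrite exprS -natr1; have : 1 <= k.+1%:R :> R by rewrite ler1n.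
  by nra.
pose n_ k := Num.truncn (rho ^+ k); pose m_ k := Num.truncn (sigma * rho ^+ k).
have nP k : (n_ k)%:R <= rho ^+ k < (n_ k)%:R + 1.
  by have := truncn_itv (ltW (rhok0 k)); rewrite natr1.
have mP k : (m_ k)%:R <= sigma * rho ^+ k < (m_ k)%:R + 1.
  by have := truncn_itv (ltW (mulr_gt0 sigma0 (rhok0 k))); rewrite natr1.
have n_grow k : (k <= n_ k)%N.
  rewrite -(ler_nat R); have := nP k; have := rhok k; rewrite -natr1; lra.
have n0 : n_ 0%N = 1%N by rewrite /n_ expr0 truncn1.
have nm k : (n_ k <= m_ k)%N.
  by apply: le_truncn; rewrite ler_peMl // ltW.
have mn k : (m_ k <= n_ k.+1)%N.
  by apply: le_truncn; rewrite exprS ler_pM2r //; rewrite rhoE; lra.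
pose free i := `[< exists k, (m_ k <= i < n_ k.+1)%N >].
have n_mono k l : (k <= l)%N -> (n_ k <= n_ l)%N.
  by move=> kl; apply: le_truncn; rewrite ler_weXn2l //; lra.
have zero k j : (n_ k <= j < m_ k)%N -> ~~ free j.
  move=> /andP[nj jm]; apply/negP => /asboolP[l /andP[mj jn]].
  have [kl|lk] := leqP k l.
    have : (m_ k <= m_ l)%N.
      by apply: le_truncn; rewrite ler_pM2l // ler_weXn2l //; lra.
    by clear -jm mj; lia.
  have := n_mono _ _ lk; clear -jn nj; lia.
have fr k j : (m_ k <= j < n_ k.+1)%N -> free j by move=> h; apply/asboolP; exists k.
exists free; split; last first.
  have [K KP] := nat_gt (v - u)^-1.
  exists (n_ K) => i Ki.
  have [|k /andP[nk kn]] := bracket_index (i := i) n_grow.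
    by apply: leq_trans Ki; exact: n_mono.
  exists (n_ k), (m_ k); split=> //; first exact: zero.
  have Kk : (K <= k)%N.
    rewrite leqNgt; apply/negP => kK; have := n_mono _ _ kK; clear -kn Ki; lia.
  rewrite natrB //.
  have h1 : u * i.+1%:R <= u * rho ^+ k.+1.
    rewrite ler_pM2l //; have /andP[nle _] := nP k.+1; apply: le_trans nle.
    by rewrite ler_nat.
  have h2 : 1 <= (v - u) * rho ^+ k.+1.
    have vu : 0 < v - u by rewrite subr_gt0.
    rewrite -ler_pdivrMl // mulr1; apply: le_trans (ltW KP) _.
    apply: le_trans (rhok _); rewrite ler_nat; clear -Kk; lia.
  have := mP k; have := nP k; rewrite exprS in h1 h2 *.
  have h3 : sigma * rho ^+ k - rho ^+ k = v * (rho * rho ^+ k).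
    by rewrite mulrA -sigma_v; ring.
  by clear -h1 h2 h3; nra.
(* As tau is below the limit 1 / sigma of free_count (n_ k) / rho^k, the gain per
   period exceeds tau (rho - 1) rho^k by a multiple of rho^k, which makes up for
   rounding from some [K] on. *)
pose tau := s1 * sigma.
have tau0 : 0 < tau by rewrite mulr_gt0.
have ts : tau * sigma < 1.
  rewrite /tau -mulrA -expr2 -ltr_pdivlMr ?exprn_gt0 // div1r -thetaE //.
have [K KP] := nat_gt (1 - tau * sigma)^-1.
pose C := tau * rho ^+ K.
have C0 : 0 < C by rewrite mulr_gt0.
have phin k : tau * rho ^+ k <= (free_count free (n_ k))%:R + C.
  elim: k => [|k IH].
    have : tau * rho ^+ 0 <= C by rewrite ler_pM2l // ler_weXn2l //; lra.
    by have : 0 <= (free_count free (n_ 0%N))%:R :> R by []; lra.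
  have [kK|Kk] := ltnP k K.
    have : tau * rho ^+ k.+1 <= C by rewrite ler_pM2l // ler_weXn2l //; lra.
    by have : 0 <= (free_count free (n_ k.+1))%:R :> R by []; lra.
  have step : (free_count free (n_ k))%:R + ((n_ k.+1)%:R - (m_ k)%:R)
      <= (free_count free (n_ k.+1))%:R :> R.
    rewrite -natrB // -natrD ler_nat -{2}(subnKC (mn k)) free_countD; last first.
      by move=> j; rewrite subnKC //; exact: fr.
    rewrite leq_add2r -(subnKC (nm k)); exact: free_countD_ge.
  have := nP k.+1; have := mP k; rewrite exprS.
  have h : 1 <= (1 - tau * sigma) * rho ^+ k.
    rewrite -ler_pdivrMl ?subr_gt0 // mulr1; apply: le_trans (ltW KP) _.
    apply: le_trans (rhok k); rewrite ler_nat; clear -Kk; lia.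
  rewrite rhoE in h IH step *; clear -h IH step; nra.
exists C => i; case: (posnP i) => [->|i0].
  by rewrite mulr0 addr_ge0 // ltW.
have [|k /andP[nk kn]] := bracket_index (i := i) n_grow; first by rewrite n0.
have s11 : s1 <= 1.
  have : s1 * sigma * sigma < 1 := ts; clear -s10 sigma1; nra.
have base : s1 * (m_ k)%:R <= tau * rho ^+ k.
  by rewrite /tau -mulrA ler_pM2l //; have /andP[] := mP k.
have [im|mi] := leqP i (m_ k).
  have h1 : s1 * i%:R <= s1 * (m_ k)%:R by rewrite ler_pM2l // ler_nat.
  have h2 : (free_count free (n_ k))%:R <= (free_count free i)%:R :> R.
    by rewrite ler_nat -(subnKC nk) free_countD_ge.
  have := phin k; clear -h1 h2 base; lra.
have h2 : (free_count free (n_ k))%:R + (i%:R - (m_ k)%:R) <= (free_count free i)%:R :> R.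
  rewrite -natrB ?(ltnW mi) // -natrD ler_nat -{2}(subnKC (ltnW mi)) free_countD.
    rewrite leq_add2r -(subnKC (nm k)); exact: free_countD_ge.
  move=> j /andP[mj]; rewrite subnKC ?(ltnW mi) // => ji.
  by apply: (fr k); rewrite mj (leq_trans ji) // ltnW.
have h3 : (m_ k)%:R <= i%:R :> R by rewrite ler_nat ltnW.
have := phin k; clear -h3 h2 base s11; nra.
Qed.

End Schedule.

(** * The Cantor set inside the uniform set *)

Section Coding.
Local Open Scope classical_set_scope.
Local Open Scope ring_scope.
Context {R : realType}.

(** X i is the sum of the a (i + j) B^-j; only its functional equation and its
    range matter. *)
Lemma expansion_exists (A B : R) (a : nat -> R) : 1 < B ->
  (forall i, 0 <= a i <= A) ->
  exists X : nat -> R, forall i, X i = a i + X i.+1 / B /\ 0 <= X i <= A / (1 - B^-1).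
Proof.
move=> B1 aA; have B0 : 0 < B by exact: lt_trans B1.
have A0 : 0 <= A by have /andP[/le_trans h /h] := aA 0%N.
pose z := B^-1; have z0 : 0 <= z by rewrite invr_ge0 ltW.
have z1 : z < 1 by rewrite invf_lt1.
pose P i n := \sum_(0 <= j < n) a (i + j)%N * z ^+ j.
have P0 i n : 0 <= P i n.
  by apply: sumr_ge0 => j _; rewrite mulr_ge0 ?exprn_ge0 //; have /andP[] := aA (i + j)%N.
have Ple i n : P i n <= A / (1 - z).
  apply: (@le_trans _ _ (\sum_(0 <= j < n) A * z ^+ j)).
    by apply: ler_sum => j _; rewrite ler_wpM2r ?exprn_ge0 //; have /andP[] := aA (i + j)%N.
  by rewrite -mulr_sumr ler_wpM2l // geometric_sum_le // z0.
have PS i n : P i n.+1 = a i + P i.+1 n / B.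
  rewrite /P big_nat_recl // addn0 expr0 mulr1; congr (_ + _).
  rewrite mulr_suml; apply: eq_bigr => j _; rewrite addnS addSn exprSr mulrA //.
have cvP i : cvgn (P i).
  apply: nondecreasing_is_cvgn.
    apply/nondecreasing_seqP => n; rewrite /P big_nat_recr //= lerDl.
    by rewrite mulr_ge0 ?exprn_ge0 //; have /andP[] := aA (i + n)%N.
  by exists (A / (1 - z)) => _ [n _ <-].
exists (fun i => limn (P i)) => i; split; last first.
  apply/andP; split; first by apply: limr_ge => //; exact: nearW.
  by apply: limr_le => //; exact: nearW.
apply: cvg_lim => //; rewrite -(cvg_shiftS (P i)) /=.
under eq_fun do rewrite PS.
by apply: cvgD; [exact: cvg_cst | apply: cvgM; [exact: cvP | exact: cvg_cst]].
Qed.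

Context (w : nat) (free : pred nat) (w0 : (0 < w)%N).
Implicit Types (y : R) (i : nat).

(** Base-[w] digits of [y], one of them consumed at each free level. *)
Fixpoint residue y i : R :=
  if i is i'.+1 then
    if free i' then w%:R * residue y i' - (Num.truncn (w%:R * residue y i'))%:R
    else residue y i'
  else y.

Definition free_digit y i : nat := Num.truncn (w%:R * residue y i).

Lemma residue_itv y i : 0 <= y < 1 -> 0 <= residue y i < 1.
Proof.
move=> y01; elim: i => //= i /andP[r0 r1]; case: ifP => _; last by rewrite r0.
have := truncn_itv (mulr_ge0 (ler0n R w) r0); rewrite -natr1; lra.
Qed.

Lemma free_digit_lt y i : 0 <= y < 1 -> (free_digit y i < w)%N.
Proof.
move=> /(residue_itv i)/andP[r0 r1]; rewrite /free_digit truncn_lt_nat ?mulr_ge0 //.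
by rewrite -[ltRHS]mulr1 ltr_pM2l // ltr0n.
Qed.

Lemma residue_dist y y' i : 0 <= y < 1 -> 0 <= y' < 1 ->
  (forall j, (j < i)%N -> free j -> free_digit y j = free_digit y' j) ->
  `|y - y'| <= (w%:R ^+ free_count free i)^-1.
Proof.
move=> y01 y'01 same.
have wr0 : 0 < w%:R :> R by rewrite ltr0n.
suff E : w%:R ^+ free_count free i * (y - y') = residue y i - residue y' i.
  have W0 : 0 < w%:R ^+ free_count free i :> R by exact: exprn_gt0.
  rewrite -[leRHS]mul1r ler_pdivlMr // mulrC -[X in X * _](gtr0_norm W0) -normrM E.
  have := residue_itv i y01; have := residue_itv i y'01.
  by rewrite ler_norml; lra.
elim: i same => [|i IH] same; first by rewrite expr0 mul1r.
have {}IH := IH (fun j ji => same j (ltnW ji)).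
rewrite free_countS /=; case fi: (free i); last by rewrite addn0.
rewrite addn1 exprS -mulrA IH -/(free_digit y i) -/(free_digit y' i) same //; ring.
Qed.

Lemma digits_differ y y' : (1 < w)%N -> 0 <= y < 1 -> 0 <= y' < 1 -> y != y' ->
  (forall K, exists i, (K <= free_count free i)%N) ->
  exists2 i, free i && (free_digit y i != free_digit y' i) &
    forall j, (j < i)%N -> free j -> free_digit y j = free_digit y' j.
Proof.
move=> w1 y01 y'01 ne unb.
have [ex|no] := pselect (exists i, free i && (free_digit y i != free_digit y' i)).
  exists (ex_minn ex); case: ex_minnP => // i _ min j ji fj.
  by apply/eqP/negPn/negP => dj; have := min j; rewrite fj dj leqNgt ji => /(_ isT).
have same i j : (j < i)%N -> free j -> free_digit y j = free_digit y' j.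
  by move=> _ fj; apply/eqP/negPn/negP => dj; apply: no; exists j; rewrite fj.
have wi : 0 <= (w%:R : R)^-1 < 1.
  by rewrite invr_ge0 ler0n invf_lt1 ?ltr0n // ltr1n.
have d0 : 0 < `|y - y'| / 2 by rewrite divr_gt0 // normr_gt0 subr_eq0.
have [M MP] := geometric_small wi d0.
have [i Mi] := unb M.
have := residue_dist y01 y'01 (same i); rewrite -exprVn.
have := MP _ Mi; move: d0; lra.
Qed.

End Coding.

Section LowerBound.
Local Open Scope classical_set_scope.
Local Open Scope ring_scope.
Context {R : realType} (beta : R) (beta1 : 1 < beta).
Local Notation T := (beta_transformation beta).

(** A digit is the left endpoint of a full cylinder of order [q], but advances the
    orbit by [q.+1] steps: the additional zero keeps the pieces of different
    digits at a distance comparable to their length. *)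
Lemma digit_alphabet (t : R) : 0 <= t < 1 ->
  exists q, (1 < size (full_endpoints beta q 1%R))%N /\
    beta `^ (t * q.+1%:R) <= (size (full_endpoints beta q 1%R))%:R.
Proof.
move=> /andP[t0 t1]; have b0 := base_gt0 beta1.
pose g := (1 + t) / 2.
have [c c0 cP] : exists2 c, 0 < c & forall n,
    c * (beta `^ g) ^+ n <= (size (full_endpoints beta n 1%R))%:R.
  apply: size_full_endpoints_ge => //; apply/andP; split.
    by apply/ltW/powR_base_gt1; rewrite // /g; lra.
  have g1 : g < 1 by rewrite /g; lra.
  by rewrite -(ltr_powR_base beta1) powRr1 ?ltW // in g1.
have k0 : 0 < (1 - t) / 2 by lra.
have zP : 0 <= beta `^ (- ((1 - t) / 2)) < 1 by apply: powR_base_lt1; rewrite // oppr_lt0.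
have e0 : 0 < c / (beta `^ t + 2).
  by rewrite divr_gt0 // addr_gt0 // powR_gt0.
(* The constant makes c gamma^q at least both beta^(t (q + 1)) and 2. *)
have [q qP] := geometric_small zP e0.
have {}qP := qP q (leqnn q).
exists q.
have key : beta `^ (t * q%:R) * (beta `^ t + 2) <= c * (beta `^ g) ^+ q.
  have -> : g = t + (1 - t) / 2 by rewrite /g; field.
  rewrite powR_baseD // exprMn -powR_base_nat // mulrCA ler_pM2l ?powR_gt0 //.
  have s0 : 0 < beta `^ t + 2 by rewrite addr_gt0 // powR_gt0.
  move: qP; rewrite powRN exprVn ler_pdivlMr // ler_pdivrMl ?exprn_gt0 ?powR_gt0 //.
  by rewrite [c * _]mulrC.
have le1 : 1 <= beta `^ (t * q%:R).
  have := ler_powR (ltW beta1) (mulr_ge0 t0 (ler0n R q)); by rewrite powRr0.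
have bt : 0 < beta `^ t by exact: powR_gt0.
split.
  rewrite -(ltr_nat R); apply: lt_le_trans (cP q); apply: lt_le_trans key; nra.
apply: le_trans (cP q); apply: le_trans key.
rewrite -natr1 mulrDr mulr1 powR_baseD // ler_pM2l ?powR_gt0 //; lra.
Qed.

(** In base B = beta^(q+1), the Cantor set of all points whose digits are taken
    from the alphabet at free levels and are 0 elsewhere lies in the uniform set,
    thanks to the zero blocks. It is coded by [0, 1[ through base-w digits,
    w being the size of the alphabet. Codes that first differ at level i are
    within w^-phi of each other, where phi counts the free levels below i, and the
    corresponding points are at least kappa B^-i apart. As w >= B^t and
    phi >= s1 i - C, with t s1 = s, this is the Holder condition of exponent s. *)
Lemma uniform_set_hausdorff_neq0 psi (u v s : R) : 0 < u < v -> v < 1 ->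
  0 <= s < ((1 - v) / (1 + v)) ^+ 2 ->
  (exists N1, forall N, (N1 <= N)%N -> beta `^ (- (u * N%:R)) < psi N) ->
  hausdorff_measure s (uniform_set beta psi) != 0%E.
Proof.
move=> uv v1 /andP[s0 slt] [N1 psiN].
have b0 := base_gt0 beta1; have bge0 := ltW b0.
have /andP[u0 _] := uv.
(* The exponent s is reached as a product: s1 < theta is what the schedule
   provides, and t < 1 what the alphabet does. *)
pose s1 := (s + ((1 - v) / (1 + v)) ^+ 2) / 2.
have s1P : 0 < s1 < ((1 - v) / (1 + v)) ^+ 2 by rewrite /s1; lra.
have s10 : 0 < s1 by have /andP[] := s1P.
pose t := s / s1.
have t01 : 0 <= t < 1.
  by rewrite divr_ge0 ?(ltW s10) //= ltr_pdivrMr // mul1r /s1; lra.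
have tE : t * s1 = s by rewrite divfK // gt_eqF.
have [q [w1 wP]] := digit_alphabet t01.
set D := full_endpoints beta q 1 in w1 wP; set w := size D in w1 wP.
have [free [[C freeC] [I0 zeros]]] := zero_schedule uv v1 s1P.
pose p := q.+1; pose B := beta ^+ p.
have B0 : 0 < B by exact: exprn_gt0.
have bB : beta <= B by rewrite /B /p exprS ler_peMr // exprn_ege1 // ltW.
have B1 : 1 < B by exact: lt_le_trans bB.
have t1 : 0 < (1 : R) <= 1 by rewrite ltr01 lexx.
have w0 : (0 < w)%N by exact: ltnW.
have Dq a : a \in D -> [/\ 0 <= a, a <= 1 - beta / B &
    forall y, 0 <= y < 1 -> iter p T (a + y / B) = y].
  move=> /(full_endpointsP beta1 t1)[a0 a1 aT]; split=> //.
    move: a1; have -> : (beta ^+ q)^-1 = beta / B.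
      by rewrite /B /p exprS invfM mulrA divff ?mul1r // gt_eqF.
    lra.
  move=> y y01; have -> : a + y / B = a + (y / beta) / beta ^+ q.
    by rewrite /B /p exprS invfM mulrA.
  have yb : 0 <= y / beta < 1.
    move: y01 => /andP[y0 y1]; rewrite divr_ge0 //= ltr_pdivrMr // mul1r.
    exact: lt_trans beta1.
  rewrite /p iterS aT //.
  by have := beta_transformation_digit beta1 0 y01; rewrite add0r.
have zeroT (y : R) l : 0 <= y < 1 -> iter (p * l) T (y / B ^+ l) = y.
  move=> /andP[y0 y1]; have E : beta ^+ (p * l) * (y / B ^+ l) = y.
    by rewrite /B -exprM mulrC divfK // gt_eqF // exprn_gt0.
  rewrite iter_beta_transformation_small ?E //.
  by rewrite divr_ge0 // exprn_ge0 // ltW.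
have A01 : 0 <= 1 - beta / B by rewrite subr_ge0 ler_pdivrMr // mul1r.
pose a (y : R) i := if free i then nth 0 D (free_digit w free y i) else 0.
have aP (y : R) i : 0 <= y < 1 -> 0 <= a y i <= 1 - beta / B.
  move=> y01; rewrite /a; case: ifP => _; last by rewrite lexx.
  by have [-> -> _] := Dq _ (mem_nth 0 (free_digit_lt free w0 i y01)).
have /choice[X XP] (y : R) : exists X : nat -> R, 0 <= y < 1 -> forall i,
    X i = a y i + X i.+1 / B /\ 0 <= X i < 1.
  have [y01|] := boolP (0 <= y < 1); last by exists (fun=> 0).
  have [X XP] := expansion_exists B1 (fun i => aP y i y01).
  exists X => _ i; have [XE /andP[X0 X1]] := XP i; split=> //.
  rewrite X0 /=; apply: le_lt_trans X1 _.
  have iB : B^-1 < 1 by rewrite invf_lt1.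
  rewrite ltr_pdivrMr ?subr_gt0 // mul1r ltrD2l ltrN2 -[ltLHS]mul1r ltr_pM2r ?invr_gt0 //.
have XT (y : R) i : 0 <= y < 1 -> iter (p * i) T (X y 0%N) = X y i.
  move=> y01; elim: i => [|i IH]; first by rewrite muln0.
  rewrite mulnS iterD IH; have [-> _] := XP y y01 i; have [_ Xi1] := XP y y01 i.+1.
  rewrite /a; case: ifP => _.
    by have [_ _ ->] := Dq _ (mem_nth 0 (free_digit_lt free w0 i y01)).
  by rewrite add0r; have := zeroT _ 1%N Xi1; rewrite muln1 expr1.
have Xzero (y : R) n l : 0 <= y < 1 -> (forall j, (n <= j < n + l)%N -> ~~ free j) ->
    X y n = X y (n + l)%N / B ^+ l.
  move=> y01; elim: l => [|l IH] zf; first by rewrite expr0 divr1 addn0.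
  rewrite IH => [|j /andP[nj jl]]; last by apply: zf; rewrite nj /=; clear -jl; lia.
  have [-> _] := XP y y01 (n + l)%N; rewrite /a (negbTE (zf _ _)) ?leq_addr ?ltn_add2l //=.
  by rewrite add0r exprS invfM addnS mulrA.
have inU (y : R) : 0 <= y < 1 -> uniform_set beta psi (X y 0%N).
  move=> y01; have [_ /andP[X0 X1]] := XP y y01 0%N; split; first by rewrite X0 ltW.
  exists (maxn N1 (p * I0)) => // N /=; rewrite geq_max => /andP[N1N I0N].
  have [|n [m [ni zf lm]]] := zeros (N %/ p)%N; first by rewrite leq_divRL // mulnC.
  exists (p * n)%N.
    by apply: leq_trans (leq_trunc_div N p); rewrite mulnC leq_mul2r ni orbT.
  rewrite XT //; apply: le_lt_trans (psiN N N1N).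
  have [nm|mn] := leqP n m; last first.
    have : 0 < u * (N %/ p).+1%:R by rewrite mulr_gt0.
    have mn0 : (m - n)%N = 0%N by apply/eqP; rewrite subn_eq0 ltnW.
    by move: lm; rewrite mn0 leNgt => /negP.
  rewrite (Xzero y n (m - n)%N) ?subnKC //.
  have [_ /andP[Xm0 Xm1]] := XP y y01 m.
  have Bl : 0 < B ^+ (m - n) by exact: exprn_gt0.
  apply: (@le_trans _ _ (B ^+ (m - n))^-1).
    by rewrite ler_pdivrMr // mulVf ?gt_eqF // ltW.
  rewrite powRN lef_pV2 ?posrE ?powR_gt0 // /B -exprM -powR_mulrn //.
  apply: ler_powR; first exact: ltW.
  have h : N%:R <= p%:R * (N %/ p).+1%:R :> R.
    by rewrite -natrM ler_nat mulnC ltnW // ltn_ceil.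
  apply: le_trans (ler_wpM2l (ltW u0) h) _.
  by rewrite natrM mulrCA ler_wpM2l.
have unb K : exists i, (K <= free_count free i)%N.
  have [i iP] := nat_gt ((K%:R + C) / s1); exists i; rewrite -(ler_nat R).
  have := freeC i; rewrite ltr_pdivrMr // mulrC in iP; lra.
pose kappa := (beta - 1) / B.
have kappa0 : 0 < kappa by rewrite divr_gt0 // subr_gt0.
have sep (y y' : R) i : 0 <= y < 1 -> 0 <= y' < 1 ->
    free i && (free_digit w free y i != free_digit w free y' i) ->
    (forall j, (j < i)%N -> free j -> free_digit w free y j = free_digit w free y' j) ->
    kappa / B ^+ i <= `|X y 0%N - X y' 0%N|.
  move=> y01 y'01 /andP[fi di] same.
  have E j : (j <= i)%N -> X y 0%N - X y' 0%N = (X y j - X y' j) / B ^+ j.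
    elim: j => [|j IH] ji; first by rewrite expr0 divr1.
    rewrite IH ?(ltnW ji) //; have [-> _] := XP y y01 j; have [-> _] := XP y' y'01 j.
    have -> : a y j = a y' j by rewrite /a; case: ifP => // fj; rewrite same.
    by rewrite exprS invfM; ring.
  have Bi : 0 < B ^+ i by exact: exprn_gt0.
  rewrite (E i (leqnn i)) normrM normfV (gtr0_norm Bi) ler_pM2r ?invr_gt0 //.
  have [-> _] := XP y y01 i; have [-> _] := XP y' y'01 i.
  have [_ X1] := XP y y01 i.+1; have [_ X1'] := XP y' y'01 i.+1.
  have aa : beta / B <= `|a y i - a y' i|.
    rewrite /a fi; have -> : beta / B = (beta ^+ q)^-1.
      by rewrite /B /p exprS invfM mulrA divff ?mul1r // gt_eqF.
    have d1 := free_digit_lt free w0 i y01; have d2 := free_digit_lt free w0 i y'01.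
    apply: full_endpoints_separated => //; try exact: mem_nth.
    by rewrite nth_uniq // full_endpoints_uniq.
  have XX : `|X y i.+1 / B - X y' i.+1 / B| <= B^-1.
    rewrite -mulrBl normrM normfV (gtr0_norm B0) ler_piMl ?invr_ge0 ?(ltW B0) //.
    by rewrite ler_norml; lra.
  rewrite /kappa mulrBl mul1r.
  have -> : a y i + X y i.+1 / B - (a y' i + X y' i.+1 / B) =
    (a y i - a y' i) - (X y' i.+1 / B - X y i.+1 / B) by ring.
  apply: le_trans (lerB_dist _ _); rewrite [X in _ <= _ - X]distrC; exact: lerB.
pose K := beta `^ (t * p%:R * C) / kappa `^ s.
have ks0 : 0 < kappa `^ s by exact: powR_gt0.
have K0 : 0 < K by rewrite divr_gt0 // powR_gt0.
apply: (@hausdorff_measure_holder_neq0 _ s K _ (fun y => X y 0%N)) => //.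
move=> y y' y01 y'01; have [->|ne] := eqVneq y y'.
  by rewrite subrr normr0 mulr_ge0 ?powR_ge0 // ltW.
have [i di same] := digits_differ w0 w1 y01 y'01 ne unb.
apply: le_trans (residue_dist w0 y01 y'01 same) _.
apply: (@le_trans _ _ (K * (kappa / B ^+ i) `^ s)); last first.
  rewrite ler_wpM2l ?(ltW K0) // ge0_ler_powR // ?nnegrE.
    exact: divr_ge0 (ltW kappa0) (exprn_ge0 i (ltW B0)).
  exact: sep.
rewrite powRM ?invr_ge0 ?exprn_ge0 ?(ltW B0) ?(ltW kappa0) // /K mulrA divfK ?gt_eqF //.
have -> : (B ^+ i)^-1 `^ s = beta `^ (- (t * p%:R * (s1 * i%:R))).
  have -> : (B ^+ i)^-1 = beta `^ (- (p * i)%:R) by rewrite powRN powR_mulrn // /B exprM.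
  by rewrite -powRrM -tE natrM; congr (_ `^ _); ring.
rewrite -powR_baseD //.
have phi : t * p%:R * (s1 * i%:R - C) <= t * p%:R * (free_count free i)%:R.
  have tp : 0 <= t * p%:R by have /andP[h _] := t01; exact: mulr_ge0.
  by apply: ler_wpM2l => //; have := freeC i; clear; lra.
apply: (@le_trans _ _ (beta `^ (- (t * p%:R * (free_count free i)%:R)))); last first.
  apply: ler_powR; first exact: ltW.
  move: phi; rewrite mulrBr; lra.
rewrite powRN lef_pV2 ?posrE ?powR_gt0 ?exprn_gt0 ?ltr0n //.
by rewrite powR_base_nat // lerXn2r // ?nnegrE ?powR_ge0.
Qed.

End LowerBound.

(** * Rates and dimension *)

Section Rates.
Local Open Scope classical_set_scope.
Local Open Scope ring_scope.
Context {R : realType} (beta : R) (beta1 : 1 < beta).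
Context (psi : nat -> R) (psi_gt0 : forall n, 0 < psi n).
Implicit Types (u v : R) (n N : nat).

Lemma psi_powR_base n : psi n = beta `^ (ln (psi n) / ln beta).
Proof.
have lb : 0 < ln beta by exact: ln_gt0.
by rewrite /powR gt_eqF ?(base_gt0 beta1) // divfK ?gt_eqF // lnK ?posrE.
Qed.

Lemma lt_log_rate v N : (0 < N)%N ->
  (v < log_rate beta psi N) = (psi N < beta `^ (- (v * N%:R))).
Proof.
by move=> N0; rewrite [in RHS]psi_powR_base ltr_powR_base // ltr_pdivlMr ?ltr0n // ltrNr.
Qed.

Lemma log_rate_lt v N : (0 < N)%N ->
  (log_rate beta psi N < v) = (beta `^ (- (v * N%:R)) < psi N).
Proof.
by move=> N0; rewrite [in RHS]psi_powR_base ltr_powR_base // ltr_pdivrMr ?ltr0n // ltrNl.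
Qed.

Lemma lower_rate_gtP v : (v%:E < lower_rate beta psi)%E ->
  exists N0, forall N, (N0 <= N)%N -> psi N < beta `^ (- (v * N%:R)).
Proof.
rewrite /lower_rate [limn_einf _]limf_einfE => /ereal_sup_gt[_ [V [M _ MV] <-] vV].
exists M.+1 => N MN; rewrite -lt_log_rate ?(leq_trans _ MN) // -lte_fin.
apply: lt_le_trans vV _; apply: ereal_inf_lbound; exists N => //.
by apply: MV; exact: ltnW.
Qed.

Lemma upper_rate_ltP u : (upper_rate beta psi < u%:E)%E ->
  exists N0, forall N, (N0 <= N)%N -> beta `^ (- (u * N%:R)) < psi N.
Proof.
rewrite /upper_rate => /ereal_inf_lt[_ [V [M _ MV] <-] vV].
exists M.+1 => N MN; rewrite -log_rate_lt ?(leq_trans _ MN) // -lte_fin.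
apply: le_lt_trans vV; apply: ereal_sup_ubound; exists N => //.
by apply: MV; exact: ltnW.
Qed.

Lemma upper_rate_gtP u : (u%:E < upper_rate beta psi)%E ->
  forall M, exists2 N, (M <= N)%N & psi N < beta `^ (- (u * N%:R)).
Proof.
move=> uup M; apply: contrapT => none; move: uup; apply/negP; rewrite -leNgt.
apply: (@le_trans _ _ (ereal_sup [set (log_rate beta psi n)%:E | n in [set n | (M.+1 <= n)%N]])).
  by apply: ereal_inf_lbound; eexists; last by []; exists M.+1.
apply: ge_ereal_sup => _ [n /= Mn <-]; rewrite lee_fin leNgt; apply/negP => lt.
apply: none; exists n; first exact: ltnW.
by rewrite -lt_log_rate // (leq_trans _ Mn).
Qed.

Lemma lower_rate_hits v : (v%:E < lower_rate beta psi)%E ->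
  forall x, uniform_set beta psi x -> uniformly_hits beta v x.
Proof.
move=> /lower_rate_gtP[N0 small] x [_ [N1 _ hit]]; exists (maxn N0 N1) => N.
rewrite geq_max => /andP[N0N N1N]; have [n nN lt] := hit N N1N.
by exists n => //; exact: lt_trans (small N N0N).
Qed.

End Rates.

Section Dimension.
Local Open Scope ring_scope.
Context {R : realType} (beta : R) (beta1 : 1 < beta).
Context (psi : nat -> R) (psi_gt0 : forall n, 0 < psi n).
Local Notation U := (uniform_set beta psi).
Local Notation lo := (lower_rate beta psi).
Local Notation up := (upper_rate beta psi).

Lemma real_between (a : R) (x : \bar R) : (a%:E < x)%E -> exists2 v, a < v & (v%:E < x)%E.
Proof.
case: x => [r| |] //; first by rewrite lte_fin => ar; exists ((a + r) / 2); rewrite ?lte_fin; lra.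
by move=> _; exists (a + 1); rewrite ?ltry //; lra.
Qed.

Lemma hausdorff_dim_uniform_set_le1 : (hausdorff_dim U <= 1)%E.
Proof.
apply: (@hausdorff_dim_le _ _ 1 2) => //; first by lra.
move=> s /andP[s1 _]; apply: (hausdorff_measure_unit_eq0 beta1) => // x [/andP[x0 x1] _].
by rewrite /= in_itv /= x0.
Qed.

Lemma hausdorff_dim_le_upper_rate : (0 <= up)%E -> (hausdorff_dim U <= 1 / (1 + up))%E.
Proof.
rewrite le_eqVlt => /orP[/eqP<-|up0].
  by rewrite adde0 div1e inve1; exact: hausdorff_dim_uniform_set_le1.
have null s : 0 < s < 1 -> ((s^-1 - 1)%:E < up)%E -> hausdorff_measure s U = 0%E.
  move=> /andP[s0 s1] /real_between[u su uup].
  have u0 : 0 < u by apply: le_lt_trans su; rewrite subr_ge0 invf_ge1 // ltW.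
  apply: (uniform_set_null_limsup beta1 u0); first by rewrite s0.
    by rewrite -ltr_pdivrMl // mulr1 -ltrBlDl.
  exact: upper_rate_gtP.
rewrite div1e; move: up0 null; case: up => [r| |] //; last first.
  move=> _ null; rewrite addey // invey.
  by apply: (@hausdorff_dim_le _ _ 0 1) => // s s01; apply: null => //; exact: ltry.
rewrite lte_fin => r0 null; rewrite -EFinD inver gt_eqF ?addr_gt0 //.
have r1 : 0 < 1 + r by rewrite addr_gt0.
apply: (@hausdorff_dim_le _ _ _ 1); [by rewrite invr_ge0 ltW| by rewrite invf_lt1 // ltrDl|].
move=> s /andP[sr s1]; have s0 : 0 < s by apply: lt_trans sr; rewrite invr_gt0.
apply: null; first by rewrite s0.
by rewrite lte_fin ltrBlDl invf_plt.
Qed.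

Lemma theta_EFin (r : R) : 0 <= r ->
  (((1 - r%:E) / (1 + r%:E)) ^+ 2)%E = (((1 - r) / (1 + r)) ^+ 2)%:E.
Proof. by move=> r0; rewrite -EFinB -EFinD inver gt_eqF ?ltr_pwDl // -EFinM EFin_expe. Qed.

Lemma hausdorff_dim_le_lower_rate (l : R) : lo = l%:E -> 0 <= l <= 1 ->
  (hausdorff_dim U <= (((1 - l) / (1 + l)) ^+ 2)%:E)%E.
Proof.
move=> loE /andP[l0 l1]; move: l0; rewrite le_eqVlt => /orP[/eqP<-|l0].
  by rewrite subr0 addr0 divr1 expr1n; exact: hausdorff_dim_uniform_set_le1.
have dl : 0 < 1 + l by lra.
have th0 : 0 <= ((1 - l) / (1 + l)) ^+ 2 by exact: sqr_ge0.
have thE : ((1 - l) / (1 + l)) ^+ 2 * (1 + l) ^+ 2 = (1 - l) ^+ 2.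
  by rewrite -exprMn divfK // gt_eqF.
set theta := (_ ^+ 2) in th0 thE *.
have th1 : theta < 1.
  rewrite -(ltr_pM2r (exprn_gt0 2 dl)) thE mul1r; nra.
apply: (@hausdorff_dim_le _ _ _ 1) => // s /andP[ths s1].
pose eta := 1 - (theta + s) / 2.
have eta01 : 0 < eta < 1 by rewrite /eta; lra.
pose gap := 4 * l - eta * (1 + l) ^+ 2.
have gap0 : 0 < gap.
  have : (theta + s) / 2 * (1 + l) ^+ 2 > theta * (1 + l) ^+ 2.
    by rewrite ltr_pM2r ?exprn_gt0 //; lra.
  rewrite thE /gap /eta; nra.
(* Moving l down by e changes 4 l by 4 e <= gap / 2, so that the discriminant
   condition survives at l - e. *)
pose e := Num.min (l / 2) (gap / 8).
have e0 : 0 < e by rewrite lt_min; apply/andP; split; lra.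
have el : e <= l / 2 by rewrite ge_min lexx.
have eg : e <= gap / 8 by rewrite ge_min lexx orbT.
pose v' := l - e; pose v := l - e / 2.
apply: (@uniform_set_null_liminf _ _ beta1 psi v v' eta s) => //.
- by rewrite /v /v'; lra.
- by rewrite /v; lra.
- have /andP[h1 h2] := eta01; rewrite /v'.
  have : eta * (1 + (l - e)) ^+ 2 <= eta * (1 + l) ^+ 2.
    by rewrite ler_pM2l // lerXn2r // ?nnegrE; lra.
  by rewrite /gap in eg gap0; lra.
- by rewrite /eta; lra.
- move=> x Ux _; apply: lower_rate_hits Ux => //.
  by rewrite loE lte_fin /v; lra.
Qed.

Lemma hausdorff_dim_ge_upper_rate (r : R) : up = r%:E -> 0 <= r <= 1 ->
  ((((1 - r) / (1 + r)) ^+ 2)%:E <= hausdorff_dim U)%E.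
Proof.
move=> upE /andP[r0 r1]; apply: hausdorff_dim_ge => s s0; rewrite lte_fin => slt.
pose q1 := (1 - r) / (1 + r); have dr : 0 < 1 + r by lra.
have q10 : 0 <= q1 by rewrite divr_ge0 //; lra.
have sq : Num.sqrt s < q1 by rewrite -(ltr_pXn2r (ltn0Sn 1)) ?nnegrE ?sqrtr_ge0 // sqr_sqrtr.
pose q := (Num.sqrt s + q1) / 2.
have q0 : 0 < q by have := sqrtr_ge0 s; rewrite /q; lra.
have qq : q < q1 by rewrite /q; lra.
(* r |-> (1 - r) / (1 + r) is a decreasing involution. *)
pose v := (1 - q) / (1 + q); have dq : 0 < 1 + q by lra.
have vr : r < v.
  rewrite /v ltr_pdivlMr //; move: qq; rewrite /q1 ltr_pdivlMr //; lra.
have v1 : v < 1 by rewrite /v ltr_pdivrMr //; lra.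
have vq : (1 - v) / (1 + v) = q by rewrite /v; field; rewrite !gt_eqF //; lra.
apply: (@uniform_set_hausdorff_neq0 _ _ beta1 psi ((r + v) / 2) v s) => //.
- by apply/andP; split; lra.
- rewrite s0 vq /= -[s]sqr_sqrtr // ltr_pXn2r ?nnegrE ?sqrtr_ge0 ?(ltW q0) //.
  by rewrite /q; lra.
- by apply: upper_rate_ltP => //; rewrite upE lte_fin; lra.
Qed.

End Dimension.

Local Open Scope ereal_scope.

(* In \bar R the library has +oo^-1 = 0, which is the convention for
   upper_rate = +oo. *)
Theorem theorem3 (R : realType) (beta : R) (psi : nat -> R)
    (beta_gt1 : (1 < beta)%R) (psi_gt0 : forall n, (0 < psi n)%R)
    (lower_rate_ge0 : 0 <= lower_rate beta psi) :
  let lo := lower_rate beta psi in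
  let up := upper_rate beta psi in
  let U := uniform_set beta psi in
  (1 < lo -> countable U) /\
  (lo <= 1 -> 1 < up ->
     0 <= hausdorff_dim U /\
     hausdorff_dim U <= mine (1 / (1 + up)) (((1 - lo) / (1 + lo)) ^+ 2)) /\
  (up <= 1 ->
     ((1 - up) / (1 + up)) ^+ 2 <= hausdorff_dim U /\
     hausdorff_dim U <= mine (1 / (1 + up)) (((1 - lo) / (1 + lo)) ^+ 2)).
Proof.
move=> lo up U.
have lo_up : lo <= up by exact: limn_einf_sup.
have up0 : 0 <= up by exact: le_trans lo_up.
have upper : lo <= 1 ->
    hausdorff_dim U <= mine (1 / (1 + up)) (((1 - lo) / (1 + lo)) ^+ 2).
  move=> lo1; rewrite le_min; apply/andP; split; first exact: hausdorff_dim_le_upper_rate.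
  have lofin : lo \is a fin_num by rewrite ge0_fin_numE // (le_lt_trans lo1) // ltry.
  have loE : lo = (fine lo)%:E by rewrite fineK.
  have lo01 : (0 <= fine lo <= 1)%R by rewrite -!lee_fin -loE lower_rate_ge0.
  rewrite loE theta_EFin; last by case/andP: lo01.
  exact: hausdorff_dim_le_lower_rate.
split; [|split] => [/real_between[v v1 vlo]|lo1 _|up1].
- by apply: (uniform_set_countable beta_gt1 v1) => x Ux _; exact: lower_rate_hits Ux.
- by split; [exact: hausdorff_dim_ge0 | exact: upper].
- split; last by apply: upper; exact: le_trans up1.
  have upfin : up \is a fin_num by rewrite ge0_fin_numE // (le_lt_trans up1) // ltry.
  have upE : up = (fine up)%:E by rewrite fineK.
  have up01 : (0 <= fine up <= 1)%R by rewrite -!lee_fin -upE up0.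
  rewrite upE theta_EFin; last by case/andP: up01.
  exact: hausdorff_dim_ge_upper_rate.
Qed.
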